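(* Let $k\ge0$. There is a constant $C>0$, independent of the mesh size $h$ and of the Lamé parameter $\lambda$, such that the discrete inf-sup condition $$\|\boldsymbol u_h\|_{1,h}\le C\sup_{0\ne\boldsymbol\sigma_h\in\Sigma_h}\frac{b_h(\boldsymbol\sigma_h,\boldsymbol u_h)}{\|\boldsymbol\sigma_h\|_{0,h}}\qquad\forall\,\boldsymbol u_h\in U_h$$ holds.
   Context: **Mesh.** Let $d\ge2$ and let $\Omega\subset\mathbb R^d$ be a bounded polytope. $\mathcal K_h$ is a shape-regular polytopal mesh of $\Omega$ whose elements $K$ are star-shaped polytopes with bounded chunkiness parameter. $\mathcal F_h^K$ is the set of all $(d-1)$-dimensional faces of $\mathcal K_h$ (including those on $\partial\Omega$), and $\mathring{\mathcal F}_h^K$ the subset of those not on $\partial\Omega$. For $K\in\mathcal K_h$ let $\boldsymbol x_K$ be the center of the largest ball inside $K$; connecting $\boldsymbol x_K$ to the vertices of $K$ splits $K$ into pyramids $T$, one with base $F$ and apex $\boldsymbol x_K$ for each face $F$ of $K$. $\mathcal T_h(K)$ is the set of these pyramids and $\mathcal T_h=\bigcup_K\mathcal T_h(K)$, which is assumed to be a shape-regular refinement of $\mathcal K_h$. $h_K,h_F$ denote diameters and $h=\max_K h_K$. **Standing assumption on elements.** For every $K\in\mathcal K_h$ with faces $F_1,\dots,F_n$ there are bases $\{b_i^m\}_{m=1}^{d(d-1)/2}$ of $\mathscr T^{F_i}(\mathbb S)$ and tensors $b_1,\dots,b_{d(d+1)/2}$ chosen among the $b_i^m$ with $\mathbb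 S=\operatorname{span}\{b_\ell\}$. Here $\mathbb S$ is the space of symmetric $d\times d$ matrices, $\mathscr T^F$ is the space of vectors tangential to $F$, and $\mathscr T^F(\mathbb S)=\operatorname{span}\{\operatorname{sym}(\boldsymbol s\otimes\boldsymbol t):\boldsymbol s,\boldsymbol t\in\mathscr T^F\}$. **Spaces.** $\mathbb P_k(D;X)$ denotes $X$-valued polynomials of degree at most $k$ on $D$. $\boldsymbol n_F$ is a unit normal of $F$. For $k\ge1$: $V_k(F)=\mathbb P_k(F;\mathbb R^d)$ and $\Sigma_k(T)=\mathbb P_k(T;\mathbb S)$. For $k=0$: $V_0(F)=\{(\boldsymbol a+\boldsymbol B\boldsymbol x)|_F:\boldsymbol a\in\mathbb R^d,\ \boldsymbol B\text{ skew-symmetric}\}$ and $\Sigma_0(T)=\operatorname{sym}(V_0(F)\otimes\boldsymbol n_F)\oplus\mathbb P_0(T;\mathscr T^F(\mathbb S))$, where $F$ is the face of $T$ in $\mathcal F_h^K$ and functions on $F$ are extended to $T$ as constant along lines perpendicular to $F$. $U_h=\{\boldsymbol u\in L^2(\Omega;\mathbb R^d):\boldsymbol u|_K\in\mathbb P_{k+1}(K;\mathbb R^d)\ \forall K\in\mathcal K_h\}$. $\Sigma_h=\{\boldsymbol\sigma\in L^2(\Omega;\mathbb S):\boldsymbol\sigma|_T\in\Sigma_k(T)\ \forall T\in\mathcal T_h,\ [\boldsymbol\sigma\boldsymbol n]|_F=0\ \forall F\in\mathring{\mathcal F}_h^K\}$. **Jumps, form, norms.** On $F=\partial T_1\cap\partial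 T_2\in\mathring{\mathcal F}_h^K$: $[\boldsymbol\sigma\boldsymbol n]=\boldsymbol\sigma|_{T_1}\boldsymbol n_1+\boldsymbol\sigma|_{T_2}\boldsymbol n_2$ with $\boldsymbol n_i$ the outward unit normal of $T_i$, $[\boldsymbol u]=\boldsymbol u|_{T_1}-\boldsymbol u|_{T_2}$, and $\boldsymbol n=\boldsymbol n_1$ in products $\langle\boldsymbol\sigma\boldsymbol n,[\boldsymbol u]\rangle_F$; on $F\subset\partial\Omega$, $[\boldsymbol u]=\boldsymbol u$ and $\boldsymbol n$ is the outward normal. $(\cdot,\cdot)_D$, $\langle\cdot,\cdot\rangle_F$ are $L^2$ inner products and $\boldsymbol\varepsilon(\boldsymbol u)=\operatorname{sym}\nabla\boldsymbol u$. $$b_h(\boldsymbol\sigma,\boldsymbol u)=-\sum_{K\in\mathcal K_h}(\boldsymbol\sigma,\boldsymbol\varepsilon(\boldsymbol u))_K+\sum_{F\in\mathcal F_h^K}\langle\boldsymbol\sigma\boldsymbol n,[\boldsymbol u]\rangle_F.$$ $\Pi_k^F$ is the $L^2(F)$-orthogonal projection onto $V_k(F)$. $\|\boldsymbol u\|_{1,h}^2=\sum_K\|\boldsymbol\varepsilon(\boldsymbol u)\|_K^2+\sum_{F\in\mathcal F_h^K}h_F^{-1}\|\Pi_k^F[\boldsymbol u]\|_F^2$ and $\|\boldsymbol\tau\|_{0,h}^2=\|\boldsymbol\tau\|^2+\sum_{F\in\mathcal F_h^K}h_F\|\boldsymbol\tau\boldsymbol n\|_F^2$. **Constants.** $C$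 may depend on $d,k$, the shape-regularity constants of the meshes, and the conditioning of the (normalized) bases $\{b_\ell\}$ of $\mathbb S$. *)

(* Defs.v *)
From HB Require Import structures.
From mathcomp Require Import all_boot all_order all_algebra.
From mathcomp Require Import all_classical all_reals all_analysis.
From mathcomp Require mpoly.

Set Implicit Arguments.
Unset Strict Implicit.
Unset Printing Implicit Defensive.
Import Order.TTheory GRing.Theory Num.Theory.
Import numFieldNormedType.Exports.

Local Open Scope classical_set_scope.
Local Open Scope ring_scope.

(** * Lebesgue measure on R^n *)

Section LebesgueN.
Variable R : realType.
Local Notation X := (measurableTypeR R).

Definition tcons n (p : X * n.-tuple X) : n.+1.-tuple X := [tuple of p.1 :: p.2].

Lemma measurable_tcons n : measurable_fun setT (@tcons n).
Proof. by apply: measurable_cons. Qed.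

Section step.
Variables (n : nat) (mu : {sigma_finite_measure set (n.-tuple X) -> \bar R}).

Definition lebesgue_step : set (n.+1.-tuple X) -> \bar R :=
  pushforward (@lebesgue_measure R \x mu)%E (@tcons n).

Let step0 : lebesgue_step set0 = 0%E.
Proof. by rewrite /lebesgue_step /pushforward preimage_set0 measure0. Qed.

Let step_ge0 A : (0 <= lebesgue_step A)%E.
Proof. by rewrite /lebesgue_step /pushforward measure_ge0. Qed.

Let step_sigma_additive : semi_sigma_additive lebesgue_step.
Proof.
move=> F mF tF mUF; rewrite /lebesgue_step /pushforward preimage_bigcup.
apply: measure_semi_sigma_additive.
- by move=> i; rewrite -[X in measurable X]setTI; exact: measurable_tcons.
- apply/trivIsetP => /= i j _ _ ij; rewrite -preimage_setI.
  by move/trivIsetP : tF => /(_ _ _ _ _ ij) ->//; rewrite preimage_set0.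
- by rewrite -preimage_bigcup -[X in measurable X]setTI; exact: measurable_tcons.
Qed.

HB.instance Definition _ :=
  isMeasure.Build _ _ _ lebesgue_step step0 step_ge0 step_sigma_additive.

Let step_sigma_finite : sigma_finite setT lebesgue_step.
Proof.
have /sigma_finiteP[F [TF ndF Foo]] := sigma_finiteT (@lebesgue_measure R).
have /sigma_finiteP[G [TG ndG Goo]] := sigma_finiteT mu.
exists (fun k => [set t : n.+1.-tuple X | F k (thead t) /\ G k [tuple of behead t]]).
  rewrite predeqE => t; split => // _.
  have [i _ Fi] : (\bigcup_k F k) (thead t) by rewrite -TF.
  have [j _ Gj] : (\bigcup_k G k) [tuple of behead t] by rewrite -TG.
  exists (maxn i j) => //; split.
    by move: Fi; apply/subsetPset/ndF/leq_maxl.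
  by move: Gj; apply/subsetPset/ndG/leq_maxr.
move=> k; have [mF Fk] := Foo k; have [mG Gk] := Goo k; split.
  apply: measurableI.
    rewrite -[X in measurable X]setTI.
    exact: (@measurable_tnth _ X n.+1 ord0).
  rewrite -[X in measurable X]setTI.
  exact: (@measurable_behead _ X n).
rewrite /lebesgue_step /pushforward.
rewrite (_ : _ @^-1` _ = F k `*` G k); last first.
  rewrite predeqE => -[x y] /=; split => -[Fx Gy]; split => //=.
    by move: Gy; congr (G k _); apply: val_inj.
  by move: Gy; congr (G k _); apply: val_inj.
by rewrite product_measure1E// lte_mul_pinfty// ge0_fin_numE.
Qed.

HB.instance Definition _ :=
  Measure_isSigmaFinite.Build _ _ _ lebesgue_step step_sigma_finite.

Definition lebesgue_stepM : {sigma_finite_measure set (n.+1.-tuple X) -> \bar R} :=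
  lebesgue_step.

End step.

Fixpoint lebesgueN n : {sigma_finite_measure set (n.-tuple X) -> \bar R} :=
  match n with
  | 0 => [the {sigma_finite_measure set (0.-tuple X) -> \bar R}
            of dirac ([tuple] : 0.-tuple X)]
  | n.+1 => lebesgue_stepM (lebesgueN n)
  end.

Definition rV_of n (t : n.-tuple X) : 'rV[R]_n := \row_i tnth t i.

(* The real-valued integral of f over D, for D a subset of R^n seen as a space
   of row vectors. *)
Definition vint n (D : set 'rV[R]_n) (f : 'rV[R]_n -> R) : R :=
  \int[lebesgueN n]_(t in [set t | D (rV_of t)]) f (rV_of t).

End LebesgueN.

(** * Vectors, matrices, polytopes *)

Section Geometry.
Variable R : realType.

(* Euclidean inner product of vectors, Frobenius inner product of matrices. The
   library's `|_| on matrices is the sup norm, hence enorm. *)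
Definition ip m n (A B : 'M[R]_(m, n)) : R := \tr (A *m B^T).
Definition enorm m n (A : 'M[R]_(m, n)) : R := Num.sqrt (ip A A).

(* Vectors are rows: mulv A x is "A x" and tens s t is "s (x) t". *)
Definition mulv n (A : 'M[R]_n) (x : 'rV[R]_n) : 'rV[R]_n := (A *m x^T)^T.
Definition tens n (s t : 'rV[R]_n) : 'M[R]_n := s^T *m t.
Definition symm n (A : 'M[R]_n) : 'M[R]_n := 2^-1 *: (A + A^T).

Variable n : nat.
Implicit Types (D : set 'rV[R]_n) (x y c : 'rV[R]_n).

Definition eball c (r : R) : set 'rV[R]_n := [set x | enorm (x - c) < r].

Definition diam D : R :=
  sup [set r | exists x y, [/\ D x, D y & r = enorm (x - y)]].

Definition bdry D : set 'rV[R]_n := closure D `\` D°.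

Definition conv_hull (s : seq 'rV[R]_n) : set 'rV[R]_n :=
  [set x | exists w : 'I_(size s) -> R,
    [/\ forall i, 0 <= w i, \sum_i w i = 1 & x = \sum_i w i *: s`_i]].

(* A nonempty, possibly nonconvex, bounded polytope of full dimension n: a finite
   union of convex polytopes without lower-dimensional parts. *)
Definition polytope D :=
  [/\ exists ss : seq (seq 'rV[R]_n), D = \bigcup_(s in [set` ss]) conv_hull s,
      D = closure D° & D !=set0].

Definition starshaped D y :=
  D y /\ forall x, D x -> forall t, 0 <= t <= 1 -> D ((1 - t) *: y + t *: x).

(* Chunkiness parameter at most rho: D is star-shaped with respect to a ball
   whose radius is at least diam D / rho. *)
Definition chunkiness_le rho D :=
  exists c r, [/\ 0 < r, eball c r `<=` starshaped D & diam D <= rho * r].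

Definition inball_ratio_le rho D :=
  exists c r, [/\ 0 < r, eball c r `<=` D & diam D <= rho * r].

Definition largest_ball_center D c :=
  exists2 r, 0 < r /\ eball c r `<=` D &
    forall y s, eball y s `<=` D -> s <= r.

Definition cone (c : 'rV[R]_n) D : set 'rV[R]_n :=
  [set x | exists y t, [/\ D y, 0 <= t <= 1 & x = (1 - t) *: c + t *: y]].

End Geometry.

(** * Faces *)

Section Facets.
Variables (R : realType) (d : nat).

(* A (d-1)-dimensional polytope in R^d, given by an isometric parametrization
   y |-> forig + y *m fframe of its hyperplane by R^(d-1), and a unit normal. *)
Record facet := Facet {
  fbase : set 'rV[R]_d.-1;
  forig : 'rV[R]_d;
  fframe : 'M[R]_(d.-1, d);
  fnrm : 'rV[R]_d }.

Implicit Types F : facet.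

Definition fmap F (y : 'rV[R]_d.-1) : 'rV[R]_d := forig F + y *m fframe F.
Definition fset_of F : set 'rV[R]_d := fmap F @` fbase F.

Definition facet_wf F :=
  [/\ polytope (fbase F), fframe F *m (fframe F)^T = 1%:M,
      fframe F *m (fnrm F)^T = 0 & ip (fnrm F) (fnrm F) = 1].

(* Integral over the face with respect to the (d-1)-dimensional surface measure. *)
Definition fint F (f : 'rV[R]_d -> R) : R := vint (fbase F) (f \o fmap F).

Definition tangential F (s : 'rV[R]_d) := ip s (fnrm F) = 0.

(* T^F(S), the span of the sym (s (x) t) with s, t tangential to F. *)
Definition tangS F : set 'M[R]_d :=
  [set A | exists (m : nat) (c : 'I_m -> R) (s t : 'I_m -> 'rV[R]_d),
    (forall i, tangential F (s i) /\ tangential F (t i)) /\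
    A = \sum_i c i *: symm (tens (s i) (t i))].

(* The extension of v from F, constant along lines perpendicular to F. *)
Definition fext F T (v : 'rV[R]_d -> T) (x : 'rV[R]_d) : T :=
  v (x - ip (x - forig F) (fnrm F) *: fnrm F).

End Facets.

Section Bases.
Variables (R : realType) (n : nat).

Definition is_basis (V : set 'M[R]_n) m (b : 'I_m -> 'M[R]_n) :=
  (forall i, V (b i)) /\
  (forall A, V A -> exists! c : 'rV[R]_m, A = \sum_i c 0 i *: b i).

(* The condition number of the Gram matrix of b is at most kappa. *)
Definition conditioning_le kappa m (b : 'I_m -> 'M[R]_n) :=
  forall c c' : 'rV[R]_m,
    enorm (\sum_i c 0 i *: b i) ^+ 2 * enorm c' ^+ 2 <=
    kappa * (enorm (\sum_i c' 0 i *: b i) ^+ 2 * enorm c ^+ 2).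

End Bases.

(** * Meshes *)

Section Meshes.
Variables (R : realType) (d : nat).

(* side1 F is the element called K_1 in the definition of the jumps on F; side2 F
   is the other element, or None if F lies on the boundary of the domain. *)
Record mesh := Mesh {
  elt : finType;
  face : finType;
  cell : elt -> set 'rV[R]_d;
  center : elt -> 'rV[R]_d;
  facet_of : face -> facet R d;
  side1 : face -> elt;
  side2 : face -> option elt }.

Variable M : mesh.
Implicit Types (K : elt M) (F : face M).

Definition incident K F : bool := (side1 F == K) || (side2 F == Some K).

Definition fset F := fset_of (facet_of F).

(* The pyramid of T_h(K) with base F and apex x_K. *)
Definition pyr K F : set 'rV[R]_d := cone (center K) (fset F).

Definition normal F : 'rV[R]_d := fnrm (facet_of F).

(* The unit normal of F pointing out of the pyramid pyr K F. *)
Definition outn K F : 'rV[R]_d :=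
  Num.sg (ip (forig (facet_of F) - center K) (normal F)) *: normal F.

Record is_mesh (Omega : set 'rV[R]_d) : Prop := IsMesh {
  mesh_domain : polytope Omega;
  mesh_cell : forall K, polytope (cell K);
  mesh_facet : forall F, facet_wf (facet_of F);
  mesh_cover : Omega = \bigcup_(K in [set: elt M]) cell K;
  mesh_disj : forall K K', K != K' -> (cell K)° `&` (cell K')° = set0;
  mesh_center : forall K, largest_ball_center (cell K) (center K);
  mesh_bdry : forall K, bdry (cell K) = \bigcup_(F in [set F | incident K F]) fset F;
  mesh_pyr : forall K, cell K = \bigcup_(F in [set F | incident K F]) pyr K F;
  mesh_pyr_disj : forall K F F', incident K F -> incident K F' -> F != F' ->
    (pyr K F)° `&` (pyr K F')° = set0;
  mesh_sides : forall F, side2 F != Some (side1 F);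
  mesh_bdry_face : forall F, side2 F = None <-> fset F `<=` bdry Omega }.

Definition shape_regular (rhoK rhoT : R) :=
  (forall K, chunkiness_le rhoK (cell K)) /\
  (forall K F, incident K F -> inball_ratio_le rhoT (pyr K F)).

(* On every element K, sel l = (F_i, m) records that b_l is the element b_i^m of
   the chosen basis of T^(F_i)(S). *)
Definition tangential_bases (kappa : R) :=
  forall K, exists (b : face M -> 'I_(d * d.-1)./2 -> 'M[R]_d)
    (sel : 'I_(d * d.+1)./2 -> face M * 'I_(d * d.-1)./2),
    let bl l := b (sel l).1 (sel l).2 in
    [/\ forall F, incident K F -> is_basis (tangS (facet_of F)) (b F),
        forall l, incident K (sel l).1,
        forall A : 'M[R]_d, A^T = A <-> exists c : 'I_(d * d.+1)./2 -> R,
          A = \sum_l c l *: bl l,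
        forall l, enorm (bl l) = 1 &
        conditioning_le kappa bl].

End Meshes.

(** * Discrete spaces, bilinear form and norms *)

Section Polynomials.
(* The notations of mpoly clash with those of the analysis library. *)
Import -(notations) mpoly.
Variables (R : realType) (d : nat).

Definition polyfun (m : nat) (f : 'rV[R]_d -> R) :=
  exists2 p : mpoly d R, (msize p <= m.+1)%N &
    forall x, f x = meval (fun i => x 0 i) p.

End Polynomials.

Section Discrete.
Variables (R : realType) (d k : nat).
Local Notation vec := 'rV[R]_d.

Definition polyvec (m : nat) (v : vec -> vec) :=
  forall i, polyfun m (fun x => v x 0 i).

(* V_k(F) consists of the restrictions to F of the following functions. *)
Definition Vk : set (vec -> vec) :=
  if k == 0%N then
    [set v | exists (a : vec) (B : 'M[R]_d),
      B^T = - B /\ forall x, v x = a + mulv B x]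
  else [set v | polyvec k v].

(* Sigma_k(T) for a pyramid T with base F. *)
Definition Sigmak (F : facet R d) : set (vec -> 'M[R]_d) :=
  if k == 0%N then
    [set tau | exists (v : vec -> vec) (A : 'M[R]_d), [/\ Vk v, tangS F A &
      forall x, tau x = symm (tens (fext F v x) (fnrm F)) + A]]
  else
    [set tau | (forall x, (tau x)^T = tau x) /\
      forall i j, polyfun k (fun x => tau x i j)].

(* A representative of the L^2(F)-orthogonal projection of g onto V_k(F). It is
   unique on F, and is only ever evaluated there. *)
Definition projF (F : facet R d) (g : vec -> vec) : vec -> vec :=
  xget (fun=> 0) [set p | Vk p /\
    forall q, Vk q -> fint F (fun x => ip (g x - p x) (q x)) = 0].

(* eps(u). The Jacobian of the library acts on rows, i.e. it is the transpose of
   the usual one, which is immaterial here. *)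
Definition eps (u : vec -> vec) (x : vec) : 'M[R]_d := symm (jacobian u x).

Variable M : mesh R d.
Implicit Types (K : elt M) (F : face M).

(* A function of L^2(Omega) that is polynomial on every element (pyramid) is
   represented by the family of its polynomial pieces, extended to R^d; the
   pieces are unique since the elements and pyramids have nonempty interior, and
   they provide the traces on the faces. The pyramids are indexed by the
   incident pairs (K, F); the other entries of such a family are ignored. *)
Definition broken_vec := elt M -> vec -> vec.
Definition broken_mx := elt M -> face M -> vec -> 'M[R]_d.

Definition Uh : set broken_vec := [set u | forall K, polyvec k.+1 (u K)].

Definition Sigmah : set broken_mx :=
  [set sigma |
    (forall K F, incident K F -> Sigmak (facet_of F) (sigma K F)) /\
    (forall F K2, side2 F = Some K2 -> forall x, fset F x ->
      mulv (sigma (side1 F) F x) (outn (side1 F) F) +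
      mulv (sigma K2 F x) (outn K2 F) = 0)].

Definition nonzero_mx (sigma : broken_mx) :=
  exists K F x, [/\ incident K F, pyr K F x & sigma K F x != 0].

(* sigma n and [u] on F, with n the normal pointing out of side1 F. *)
Definition sigman (sigma : broken_mx) F (x : vec) : vec :=
  mulv (sigma (side1 F) F x) (outn (side1 F) F).

Definition jump (u : broken_vec) F (x : vec) : vec :=
  u (side1 F) x - (if side2 F is Some K2 then u K2 x else 0).

Definition bh (sigma : broken_mx) (u : broken_vec) : R :=
  - (\sum_K \sum_(F | incident K F)
      vint (pyr K F) (fun x => ip (sigma K F x) (eps (u K) x)))
  + \sum_F fint (facet_of F) (fun x => ip (sigman sigma F x) (jump u F x)).

Definition norm1h (u : broken_vec) : R :=
  Num.sqrt (\sum_K vint (cell K) (fun x => enorm (eps (u K) x) ^+ 2)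
    + \sum_F (diam (fset F))^-1 *
        fint (facet_of F)
          (fun x => enorm (projF (facet_of F) (jump u F) x) ^+ 2)).

Definition norm0h (tau : broken_mx) : R :=
  Num.sqrt (\sum_K \sum_(F | incident K F)
      vint (pyr K F) (fun x => enorm (tau K F x) ^+ 2)
    + \sum_F diam (fset F) *
        fint (facet_of F) (fun x => enorm (sigman tau F x) ^+ 2)).

End Discrete.

(* Main.v *)
From HB Require Import structures.
Require Import Defs.
From mathcomp Require Import all_boot all_order all_algebra.
From mathcomp Require Import all_classical all_reals all_analysis.
From mathcomp Require mpoly.
From mathcomp Require Import measurable_realfun.
From mathcomp Require Import ring lra zify.

Set Implicit Arguments.
Unset Strict Implicit.
Unset Printing Implicit Defensive.
Import Order.TTheory GRing.Theory Num.Theory.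
Import numFieldNormedType.Exports.

Local Open Scope classical_set_scope.
Local Open Scope ring_scope.

(** The jump part of [u] is tested with a tensor whose normal component on a face
    [F] is [h_F^-1 Pi_k^F [u]], extended to the adjacent pyramids as constant along
    the normal. The strain part is tested with [- sum_l (eps u : b_l) b_l], each term
    being put on the pyramid to whose base [b_l] is tangential: it has no normal
    component on the faces, and it controls [eps u] because the polynomial
    [eps u : b_l] is as large on one pyramid as on the whole element. A large enough
    multiple of the second tensor absorbs the cross term of the first one.

    All the norm equivalences come from one fact: a polynomial of bounded degree is
    bounded on the dilate of a cube by its [L^2] mean over the cube. This replaces
    scaling to a reference element, and it only needs the Lebesgue measure to behave
    well under dilations and translations, not under rotations. *)

(** With [norm1h^2 <= 2 bh] and [norm0h^2 <= C4 norm1h^2] for one test tensor, multiplying [norm1h]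
    by [norm0h] gives the inf-sup bound. Three obstacles shape the rest. The test tensor must be
    symmetric with a prescribed normal component [q]. Solving [mulv (symm (tens w n)) n = q] gives
    [w = 2 q - (q . n) n]. For [k = 0], [w] must again be a rigid motion on the face, and this is
    where the precise form of [V_0] enters. Shape regularity provides balls in elements and
    pyramids, while the face terms need a ball in the face whose radius is comparable with the
    diameter of the element. Slicing a pyramid parallel to its base yields one. No bound on the
    number of faces of an element is available at hand: sums over faces are regrouped by the index
    [l] of the basis, compared with integrals over disjoint cubes, or exchanged with the sum over
    elements. If [norm1h u = 0], the test tensor has norm zero and cannot enter the supremum;
    another nonzero tensor with [bh >= 0] then shows that the supremum is nonnegative. *)

(** * Polynomial functions *)

Section Polyfun.
Import -(notations) mpoly.
Variables (R : realType) (n : nat).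
Implicit Types (f g : 'rV[R]_n -> R) (s : seq 'I_n).

Lemma polyfun_ext m f g : f =1 g -> polyfun m f -> polyfun m g.
Proof. by move=> /funext ->. Qed.

Lemma polyfun_le m m' f : (m <= m')%N -> polyfun m f -> polyfun m' f.
Proof. by move=> le_m [p sp fp]; exists p => //; apply: leq_trans sp _. Qed.

Lemma polyfun_cst m (a : R) : polyfun m (fun _ : 'rV[R]_n => a).
Proof.
exists (mpolyC n a) => [|x]; last by rewrite mevalC.
by rewrite mmeasureC; case: (a != 0).
Qed.

Lemma polyfun_coord i : polyfun 1 (fun x : 'rV[R]_n => x 0 i).
Proof. by exists (mpolyX R (mnm1 i)) => [|x]; rewrite ?msizeX ?mdeg1 ?mevalXU. Qed.

Lemma polyfunD m f g : polyfun m f -> polyfun m g ->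
  polyfun m (fun x => f x + g x).
Proof.
move=> [p sp fp] [q sq gq]; exists (p + q) => [|x]; last by rewrite mevalD fp gq.
by apply: leq_trans (msizeD_le _ _) _; rewrite geq_max sp.
Qed.

Lemma polyfunM m m' f g : polyfun m f -> polyfun m' g ->
  polyfun (m + m') (fun x => f x * g x).
Proof.
move=> [p sp fp] [q sq gq]; exists (p * q) => [|x]; last by rewrite mevalM fp gq.
have [->|p0] := eqVneq p 0; first by rewrite mul0r msize0.
have [->|q0] := eqVneq q 0; first by rewrite mulr0 msize0.
rewrite msizeM//; move: sp sq; move: (msize p) (msize q) => a b.
lia.
Qed.

Lemma polyfunZ m a f : polyfun m f -> polyfun m (fun x => a * f x).
Proof. by move=> pf; have := polyfunM (polyfun_cst 0 a) pf. Qed.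

Lemma polyfunN m f : polyfun m f -> polyfun m (fun x => - f x).
Proof.
by move=> pf; apply: polyfun_ext (polyfunZ (-1) pf) => x; rewrite mulN1r.
Qed.

Lemma polyfunB m f g : polyfun m f -> polyfun m g ->
  polyfun m (fun x => f x - g x).
Proof. by move=> pf pg; apply: polyfunD pf (polyfunN pg). Qed.

Lemma polyfun_sum m (I : Type) (r : seq I) (P : pred I) (F : I -> 'rV[R]_n -> R) :
  (forall i, P i -> polyfun m (F i)) -> polyfun m (fun x => \sum_(i <- r | P i) F i x).
Proof.
move=> pF; elim: r => [|i r IH].
  by apply: polyfun_ext (polyfun_cst m 0) => x; rewrite big_nil.
have [Pi|nPi] := boolP (P i).
  by apply: polyfun_ext (polyfunD (pF _ Pi) IH) => x; rewrite big_cons Pi.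
by apply: polyfun_ext IH => x; rewrite big_cons (negbTE nPi).
Qed.

Definition monomial s (x : 'rV[R]_n) : R := \prod_(i <- s) x 0 i.

(* A polynomial is a combination of products of lists of coordinates: lists
   rather than exponents make the inductions below structural. *)
Lemma polyfun_monomials m f : polyfun m f ->
  exists (r : seq (R * seq 'I_n)), all (fun a => size a.2 <= m)%N r /\
    f = fun x => \sum_(a <- r) a.1 * monomial a.2 x.
Proof.
move=> [p sp fp].
pose t (u : multinom n) : seq 'I_n := flatten [seq nseq (u i) i | i <- enum 'I_n].
exists [seq (mcoeff u p, t u) | u <- msupp p]; split.
  rewrite all_map; apply/allP => u up /=.
  suff -> : size (t u) = mdeg u by rewrite -ltnS; apply: leq_trans (msize_mdeg_lt up) sp.
  rewrite mdegE /t size_flatten /shape -map_comp sumnE big_map big_enum /=.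
  by apply: eq_big => // i _; rewrite /= size_nseq.
apply/funext => x; rewrite fp mevalE [in RHS]big_map; apply: eq_bigr => u _; congr (_ * _).
rewrite /monomial /t big_flatten big_map big_enum /=; apply: eq_bigr => i _.
by rewrite big_nseq; elim: (u i) => // v /=; rewrite exprS => <-.
Qed.

(** Reduces restriction to lines, differentiability, measurability and boundedness of polynomials to
    the case of a product of coordinates. *)
Lemma polyfun_ind m (P : ('rV[R]_n -> R) -> Prop) :
  P (fun=> 0) -> (forall f g, P f -> P g -> P (fun x => f x + g x)) ->
  (forall a f, P f -> P (fun x => a * f x)) ->
  (forall s, (size s <= m)%N -> P (monomial s)) ->
  forall f, polyfun m f -> P f.
Proof.
move=> P0 PD PZ Pm f /polyfun_monomials[r [rm ->]].
elim: r rm => [_|a r IH /= /andP[am rm]].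
  by rewrite (_ : (fun _ => _) = fun=> 0)//; apply/funext => x; rewrite big_nil.
have := PD _ _ (PZ a.1 _ (Pm _ am)) (IH rm).
by congr P; apply/funext => x; rewrite big_cons.
Qed.

Lemma polyfun_line m f x y : polyfun m f ->
  exists2 q : {poly R}, (size q <= m.+1)%N & forall t : R, f (x + t *: y) = q.[t].
Proof.
move: f; apply: polyfun_ind.
- by exists 0 => [|s]; rewrite ?size_poly0 ?horner0.
- move=> f g [p sp fp] [q sq gq]; exists (p + q) => [|s]; last by rewrite hornerD fp gq.
  by apply: leq_trans (size_polyD _ _) _; rewrite geq_max sp.
- move=> a f [p sp fp]; exists (a *: p) => [|s]; last by rewrite hornerZ fp.
  exact: leq_trans (size_scale_leq _ _) _.
move=> s sm; exists (\prod_(i <- s) ((x 0 i)%:P + y 0 i *: 'X)) => [|z].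
  apply: leq_trans (_ : _ <= (size s).+1)%N _ => //; elim: s {sm} => [|i s IH].
    by rewrite big_nil size_poly1.
  rewrite big_cons; apply: leq_trans (size_polyMleq _ _) _.
  have : (size ((x 0 i)%:P + y 0 i *: 'X)%R <= 2)%N.
    apply: leq_trans (size_polyD _ _) _; rewrite geq_max.
    rewrite (leq_trans (size_polyC_leq1 _))//.
    by apply: leq_trans (size_scale_leq _ _) _; rewrite size_polyX.
  by move=> /leq_add /(_ IH) /=; move: (size _ + size _)%N (size s) => a b; lia.
rewrite horner_prod; apply: eq_bigr => i _.
by rewrite !hornerE !mxE mulrC.
Qed.

(** The partial derivatives come as polynomials of one degree less, in a form from which the
    Jacobian can be read off; this makes the strain of a displacement of degree [k+1] a polynomial
    of degree [k]. *)
Lemma polyfun_gradient m f : polyfun m.+1 f ->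
  exists2 g : 'I_n -> 'rV[R]_n -> R, forall i, polyfun m (g i) &
    forall x : 'rV[R]_n, is_diff x f (fun h => \sum_i h 0 i * g i x).
Proof.
move: f; apply: polyfun_ind.
- exists (fun _ _ => 0) => [i|x]; first exact: polyfun_cst.
  apply: is_diff_eq; apply/funext => h /=.
  by rewrite big1// => i _; rewrite mulr0.
- move=> f g [df Df Ef] [dg Dg Eg]; exists (fun i x => df i x + dg i x) => [i|x].
    exact: polyfunD.
  have := Ef x; have := Eg x => ? ?.
  apply: (@is_diff_eq _ _ _ (f + g)) => //; apply/funext => h /=.
  by under [RHS]eq_bigr do rewrite mulrDr; rewrite big_split.
- move=> a f [df Df Ef]; exists (fun i x => a * df i x) => [i|x].
    exact: polyfunZ.
  have := Ef x => ?; apply: (@is_diff_eq _ _ _ (a *: f)) => //; apply/funext => h.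
  rewrite /= [LHS]mulr_sumr; apply: eq_bigr => i _; exact: mulrCA.
move=> s; case: s => [_|i0 s sm].
  exists (fun _ _ => 0) => [i|x]; first exact: polyfun_cst.
  rewrite (_ : monomial _ = cst 1); last first.
    by apply/funext => y; rewrite /monomial big_nil.
  apply: is_diff_eq; apply/funext => h.
  by rewrite /= big1// => i _; rewrite mulr0.
(* The degree is tied to the length of the list, one less than that of [i0 :: s], so that the
   induction on [s] can use the product rule. *)
suff [g Pg Dg] : exists2 g : 'I_n -> 'rV[R]_n -> R, forall i, polyfun (size s) (g i) &
    forall x : 'rV[R]_n, is_diff x (monomial (i0 :: s)) (fun h => \sum_i h 0 i * g i x).
  by exists g => // i; apply: polyfun_le (Pg i).
have coordD (i : 'I_n) (x : 'rV[R]_n) :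
    is_diff x (fun y : 'rV[R]_n => y 0 i) (fun h => h 0 i).
  have lin : linear (fun y : 'rV[R]_n => y 0 i) by move=> c u v; rewrite !mxE.
  pose f : 'rV[R]_n -> R^o := fun y => y 0 i.
  pose fL := GRing.isLinear.Build _ _ _ _ f lin.
  pose L : {linear 'rV[R]_n -> R^o} := HB.pack f fL.
  have cL : continuous L by move=> y; exact: coord_continuous.
  have dL := @linear_differentiable _ _ _ L x cL.
  exact: (DiffDef (Phantom _ (nbhs x)) dL (@diff_lin _ _ _ L x cL)).
elim: s i0 {sm} => [|i1 s IH] i0.
  exists (fun i _ => (i == i0)%:R) => [i|x]; first exact: polyfun_cst.
  rewrite (_ : monomial _ = fun y => y 0 i0); last first.
    by apply/funext => y; rewrite /monomial big_seq1.
  apply: is_diff_eq; apply/funext => h /=.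
  rewrite (bigD1 i0)//= eqxx mulr1 big1 ?addr0// => i /negbTE ->.
  by rewrite mulr0.
have [g Pg Dg] := IH i1.
exists (fun i x => (i == i0)%:R * monomial (i1 :: s) x + x 0 i0 * g i x) => [i|x].
  apply: polyfunD.
    apply: polyfunZ; have {Pg IH g Dg} : forall s', polyfun (size s') (monomial s').
      elim=> [|j s' IHs]; first by apply: polyfun_ext (polyfun_cst 0 1) => y; rewrite /monomial big_nil.
      by apply: polyfun_ext (polyfunM (polyfun_coord j) IHs) => y; rewrite /monomial big_cons.
    exact.
  exact: polyfunM (polyfun_coord i0) (Pg i).
rewrite (_ : monomial _ = ((fun y => y 0 i0) : 'rV[R]_n -> R) * monomial (i1 :: s)); last first.
  by apply/funext => y; rewrite /monomial big_cons.
have := Dg x => ?; apply: is_diff_eq; apply/funext => h /=.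
rewrite [LHS]/(_ + _) /= /(_ *: _) /=.
rewrite [in RHS](eq_bigr (fun i => (h 0 i * (i == i0)%:R * monomial (i1 :: s) x) +
    x 0 i0 * (h 0 i * g i x))); last first.
  by move=> i _; ring.
rewrite big_split/= addrC -mulr_sumr -mulr_suml; congr (_ + _).
  rewrite mulrC; congr (_ * _).
  rewrite (bigD1 i0)//= eqxx mulr1 big1 ?addr0// => i /negbTE ->.
  by rewrite mulr0.
Qed.

End Polyfun.

Lemma polyfun_comp_affine (R : realType) n n' m (f : 'rV[R]_n -> R)
    (phi : 'rV[R]_n' -> 'rV[R]_n) :
  (forall i, polyfun 1 (fun x => phi x 0 i)) -> polyfun m f ->
  polyfun m (f \o phi).
Proof.
move=> Hphi; move: f; apply: polyfun_ind.
- exact: polyfun_cst.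
- by move=> f g; exact: polyfunD.
- by move=> a f; exact: polyfunZ.
move=> s sm; apply: polyfun_le sm _; elim: s => [|i s IH].
  by apply: polyfun_ext (polyfun_cst _ 0 1) => x; rewrite /= /monomial big_nil.
by apply: polyfun_ext (polyfunM (Hphi i) IH) => x; rewrite /= /monomial big_cons.
Qed.

(** * Lebesgue measure: Tonelli, homotheties, cubes, open sets *)

Section LebesgueN.
Variable R : realType.
Local Notation X := (measurableTypeR R).

Lemma integral_lebesgueNS n (f : n.+1.-tuple X -> \bar R) :
  measurable_fun setT f -> (forall t, 0 <= f t)%E ->
  (\int[lebesgueN R n.+1]_t f t =
   \int[@lebesgue_measure R]_x \int[lebesgueN R n]_t f (tcons (x, t)))%E.
Proof.
move=> mf f0; have mc := @measurable_tcons R n.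
rewrite [LHS](ge0_integral_pushforward mc)//.
have mft : measurable_fun setT (f \o @tcons R n) by exact: measurableT_comp mf mc.
rewrite preimage_setT; exact: (fubini_tonelli1 _ mft (fun=> f0 _)).
Qed.

(** The image of Lebesgue measure under [x |-> a + s x], multiplied by [s], has the right value on
    half-open intervals, hence is Lebesgue measure by uniqueness. *)
Lemma ge0_integral_affine1 (f : X -> \bar R) (a s : R) : 0 < s ->
  measurable_fun setT f -> (forall x, 0 <= f x)%E ->
  (s%:E * \int[@lebesgue_measure R]_x f (a + s * x)%R =
   \int[@lebesgue_measure R]_x f x)%E.
Proof.
move=> s0 mf f0.
pose phi : X -> X := fun x => a + s * x.
have mphi : measurable_fun setT phi.
  by apply: measurable_funD => //; exact: measurable_funM.
pose ns := NngNum (ltW s0).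
pose muf : {measure set X -> \bar R} := mscale ns (pushforward (@lebesgue_measure R) phi).
pose mu := muf mphi.
have muE : forall A, measurable A -> lebesgue_measure A = mu A.
  apply: lebesgue_measure_unique => _ [[u v] _ <-] /=.
  rewrite /mu /muf /= /mscale /= /pushforward.
  rewrite (_ : _ @^-1` _ = `](u - a) / s, (v - a) / s]%classic); last first.
    apply/seteqP; split => x /=; rewrite !in_itv/= /phi => /andP[h1 h2];
      apply/andP; split; [ | | |].
    - by rewrite ltr_pdivrMr//; lra.
    - by rewrite ler_pdivlMr//; lra.
    - by move: h1; rewrite ltr_pdivrMr//; lra.
    - by move: h2; rewrite ler_pdivlMr//; lra.
  rewrite !lebesgue_measure_itv/= !lte_fin ltr_pM2r ?invr_gt0// ltrD2r.
  case: ifPn => uv; last by rewrite mule0.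
  rewrite -!EFinB -EFinM; congr EFin; field; exact: lt0r_neq0.
transitivity (\int[mu]_x f x)%E; last first.
  by apply: eq_measure_integral => A mA _; exact/esym/muE.
rewrite (ge0_integral_mscale _ _ ns)//.
by rewrite (ge0_integral_pushforward mphi)// preimage_setT.
Qed.

Definition afft n (a : n.-tuple X) (s : R) (t : n.-tuple X) : n.-tuple X :=
  [tuple tnth a i + s * tnth t i | i < n].

Lemma measurable_afft n a s : measurable_fun setT (@afft n a s).
Proof.
apply/measurable_fun_tnthP => i.
rewrite (_ : _ \o _ = fun t => tnth a i + s * tnth t i); last first.
  by apply/funext => t; rewrite /= tnth_mktuple.
by apply: measurable_funD => //; apply: measurable_funM => //; exact: measurable_tnth.
Qed.

Lemma afft_tcons n (a : n.+1.-tuple X) s x t :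
  afft a s (tcons (x, t)) =
  tcons (thead a + s * x, afft [tuple of behead a] s t).
Proof.
apply: eq_from_tnth => i; rewrite tnth_mktuple.
case: (unliftP ord0 i) => [j ->|->]; rewrite ?tnthS ?tnth0//.
by rewrite /= tnth_mktuple tnth_behead; congr (tnth a _ + _); apply/val_inj; rewrite /= inordK// ltnS.
Qed.

(** Induction on the dimension: Tonelli splits off the first coordinate, and the map acts on each
    coordinate separately. *)
Lemma ge0_integral_affine n (f : n.-tuple X -> \bar R) a (s : R) : 0 < s ->
  measurable_fun setT f -> (forall t, 0 <= f t)%E ->
  ((s ^+ n)%:E * \int[lebesgueN R n]_t f (afft a s t) =
   \int[lebesgueN R n]_t f t)%E.
Proof.
move=> s0; elim: n f a => [|n IH] f a mf f0.
  rewrite expr0 mul1e; apply: eq_integral => t _; congr f.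
  by rewrite tuple0 [RHS]tuple0.
rewrite !integral_lebesgueNS//; last first.
  by apply: measurableT_comp => //; exact: measurable_afft.
under eq_integral do under eq_integral do rewrite afft_tcons.
have mt x : measurable_fun setT (fun t => f (tcons (x, t))).
  by apply: measurableT_comp => //; apply: measurableT_comp => //; exact: measurable_tcons.
pose G x := (\int[lebesgueN R n]_t f (tcons (x, t)))%E.
have mG : measurable_fun setT G.
  apply: (@measurable_fun_fubini_tonelli_F _ _ _ _ _ (lebesgueN R n) (fun z => f (tcons z))) => //.
  by apply: measurableT_comp => //; exact: measurable_tcons.
have G0 x : (0 <= G x)%E by apply: integral_ge0.
rewrite -[RHS](@ge0_integral_affine1 G (thead a) s s0 mG G0).
have mGa : measurable_fun setT (fun x => G (thead a + s * x)).
  apply: measurableT_comp => //.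
  by apply: measurable_funD => //; exact: measurable_funM.
rewrite exprS EFinM -muleA; congr (_ * _)%E.
have GE x : G x = ((s ^+ n)%:E * \int[lebesgueN R n]_t f (tcons (x, afft [tuple of behead a] s t)))%E.
  by rewrite (IH (fun t => f (tcons (x, t)))).
under [RHS]eq_integral do rewrite GE.
rewrite ge0_integralZl//.
- apply: (@measurable_fun_fubini_tonelli_F _ _ _ _ _ (lebesgueN R n)
    (fun z => f (tcons (thead a + s * z.1, afft [tuple of behead a] s z.2)))) => //.
  apply: measurableT_comp => //; apply: measurableT_comp; first exact: measurable_tcons.
  apply: measurable_fun_pair => /=.
    by apply: measurable_funD => //; exact: measurable_funM.
  by apply: measurableT_comp => //; exact: measurable_afft.
- by move=> x _; exact: integral_ge0.
- by rewrite lee_fin exprn_ge0// ltW.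
Qed.

Definition cube n (c : 'rV[R]_n) (l : R) : set 'rV[R]_n :=
  [set x | forall i, `|x 0 i - c 0 i| < l].

(** The measure lives on tuples, the geometry on row vectors; [preT] carries a set from the latter
    to the former. *)
Definition preT n (D : set 'rV[R]_n) : set (n.-tuple X) := [set t | D (rV_of t)].

Lemma measurable_cube n (c : 'rV[R]_n) l : measurable (preT (cube c l)).
Proof.
rewrite (_ : preT _ = \bigcap_(i in [set: 'I_n])
    ((@tnth _ X ^~ i) @^-1` [set y | `|y - c 0 i| < l])); last first.
  apply/seteqP; split => t /= h i; first by move=> _; have := h i; rewrite mxE.
  by rewrite mxE; exact: h.
apply: fin_bigcap_measurable; first exact: finite_finset.
move=> i _; rewrite -[X in measurable X]setTI; apply: measurable_tnth => //.
rewrite (_ : [set _ | _] = ball (c 0 i) l); first exact: measurable_ball.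
by apply/seteqP; split => y; rewrite /ball/= distrC.
Qed.

Lemma lebesgueN_cube n (c : 'rV[R]_n) l : 0 < l ->
  lebesgueN R n (preT (cube c l)) = ((2 * l) ^+ n)%:E.
Proof.
move=> l0; elim: n c => [|n IH] c.
  rewrite expr0 (_ : preT _ = setT); first exact: diracT.
  by apply/seteqP; split => // t _ [].
rewrite [LHS]/= /lebesgue_step /pushforward.
pose c' : 'rV[R]_n := \row_i c 0 (lift ord0 i).
rewrite (_ : _ @^-1` _ = ball (c 0 ord0) l `*` preT (cube c' l)).
  rewrite product_measure1E//; [|exact: measurable_ball|exact: measurable_cube].
  rewrite IH exprS EFinM [X in (X * _)%E = _](lebesgue_measure_ball _ (ltW l0)).
  by rewrite mulr_natl.
apply/seteqP; split => -[x t] /=.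
  move=> h; split.
    by have := h ord0; rewrite mxE tnth0 distrC.
  by move=> i; have := h (lift ord0 i); rewrite !mxE tnthS.
move=> [h1 h2] i; rewrite mxE; case: (unliftP ord0 i) => [j ->|->].
  by rewrite tnthS; have := h2 j; rewrite !mxE.
by rewrite tnth0 distrC.
Qed.

(** An open set is the union of the countably many cubes with rational centre and size that it
    contains. *)
Lemma open_measurable_preT n (O : set 'rV[R]_n) : open O -> measurable (preT O).
Proof.
move=> oO.
pose cu (q : 'rV[rat]_n * rat) := cube (map_mx ratr q.1) (ratr q.2 : R).
rewrite (_ : preT O = \bigcup_(q : 'rV[rat]_n * rat)
   (if `[< cu q `<=` O >] then preT (cu q) else set0)).
  apply: countable_bigcupT_measurable => [|q]; first exact: countableP.
  by case: ifP => _ //; exact: measurable_cube.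
apply/seteqP; split => t /=; last first.
  by move=> [q _]; case: ifP => // /asboolP qO; apply: qO.
move=> Ot; have /nbhs_ballP[e e0 eO] := open_nbhs_nbhs (conj oO Ot).
have e4 : 0 < e / 2 by rewrite divr_gt0.
have [l] := rat_in_itvoo e4; rewrite in_itv/= => /andP[l0 le].
have q_ex i : exists q : rat, `|rV_of t 0 i - ratr q| < (ratr l : R).
  have : rV_of t 0 i - ratr l < rV_of t 0 i by rewrite gtrBl.
  by move=> /rat_in_itvoo[q]; rewrite in_itv/= => /andP[q1 q2]; exists q; rewrite ltr_norml; lra.
have [q Hq] := choice q_ex.
exists (\row_i q i, l) => //.
case: ifPn => [_ i|/negP]; first by rewrite /= !mxE; have := Hq i; rewrite mxE.
case; apply/asboolP => y Hy; apply: eO; split => // i j; rewrite /ball/= ord1.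
have := Hy j; have := Hq j; rewrite /= !mxE !ltr_norml => /andP[? ?] /andP[? ?].
by apply/andP; split; lra.
Qed.

End LebesgueN.

(** * Integrals of polynomials over bounded measurable sets *)

Definition ispoly (R : realType) n (f : 'rV[R]_n -> R) := exists m, polyfun m f.

Section IsPoly.
Variables (R : realType) (n : nat).
Implicit Types f g : 'rV[R]_n -> R.

Lemma ispolyD f g : ispoly f -> ispoly g -> ispoly (fun x => f x + g x).
Proof.
move=> [m pf] [m' pg]; exists (maxn m m'); apply: polyfunD.
  exact: polyfun_le (leq_maxl _ _) pf.
exact: polyfun_le (leq_maxr _ _) pg.
Qed.

Lemma ispolyM f g : ispoly f -> ispoly g -> ispoly (fun x => f x * g x).
Proof. by move=> [m pf] [m' pg]; exists (m + m')%N; exact: polyfunM. Qed.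

Lemma ispoly_cst (a : R) : ispoly (fun _ : 'rV[R]_n => a).
Proof. by exists 0%N; exact: polyfun_cst. Qed.

Lemma ispolyZ a f : ispoly f -> ispoly (fun x => a * f x).
Proof. by move=> [m pf]; exists m; exact: polyfunZ. Qed.

Lemma ispolyN f : ispoly f -> ispoly (fun x => - f x).
Proof. by move=> [m pf]; exists m; exact: polyfunN. Qed.

Lemma ispolyX f k : ispoly f -> ispoly (fun x => f x ^+ k).
Proof.
move=> pf; elim: k => [|k IH]; first exact: ispoly_cst.
by under eq_fun do rewrite exprS; exact: ispolyM.
Qed.

Lemma ispoly_sum (I : Type) (r : seq I) (P : pred I) (F : I -> 'rV[R]_n -> R) :
  (forall i, P i -> ispoly (F i)) -> ispoly (fun x => \sum_(i <- r | P i) F i x).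
Proof.
move=> pF; elim: r => [|i r IH].
  by under eq_fun do rewrite big_nil; exact: ispoly_cst.
have [Pi|nPi] := boolP (P i); last by under eq_fun do rewrite big_cons (negbTE nPi).
by under eq_fun do rewrite big_cons Pi; apply: ispolyD => //; exact: pF.
Qed.

End IsPoly.

Section Vint.
Variables (R : realType) (n : nat).
Implicit Types (f g : 'rV[R]_n -> R) (D : set 'rV[R]_n).
Local Notation X := (measurableTypeR R).

(** Exactly what makes every polynomial integrable over [D]: finite measure and bounded values. *)
Definition tame D :=
  measurable (preT D) /\ exists B : R, forall x, D x -> forall i, `|x 0 i| <= B.

Lemma measurable_ispoly f : ispoly f ->
  measurable_fun setT (fun t : n.-tuple X => f (rV_of t)).
Proof.
move=> [m]; move: f; apply: polyfun_ind.
- exact: measurable_cst.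
- by move=> f g mf mg; exact: measurable_funD.
- by move=> a f mf; exact: measurable_funM.
move=> s _; rewrite /monomial; apply: (@measurable_prod _ _ R _ _ s (fun i t => rV_of t 0 i)) => i _.
rewrite (_ : (fun _ => _) = @tnth _ X ^~ i); first exact: measurable_tnth.
by apply/funext => t; rewrite mxE.
Qed.

Lemma bounded_ispoly f (B : R) : ispoly f ->
  exists C, forall x : 'rV[R]_n, (forall i, `|x 0 i| <= B) -> `|f x| <= C.
Proof.
move=> [m]; move: f; apply: polyfun_ind.
- by exists 0 => x _; rewrite normr0.
- move=> f g [C fC] [C' gC]; exists (C + C') => x Bx.
  by apply: le_trans (ler_normD _ _) _; apply: lerD; [exact: fC|exact: gC].
- by move=> a f [C fC]; exists (`|a| * C) => x Bx; rewrite normrM ler_wpM2l// fC.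
move=> s _; exists (\prod_(i <- s) B) => x Bx.
by rewrite /monomial normr_prod; apply: ler_prod => i _; rewrite normr_ge0 Bx.
Qed.

Lemma tame_fin_measure D : tame D -> (lebesgueN R n (preT D) < +oo)%E.
Proof.
move=> [mD [B HB]]; have B1 : 0 < `|B| + 1 by rewrite ltr_wpDl.
apply: le_lt_trans (_ : (_ <= lebesgueN R n (preT (cube 0 (`|B| + 1))))%E) _.
  apply: le_measure; rewrite ?inE//; first exact: measurable_cube.
  move=> t /HB Ht i; rewrite [X in _ - X]mxE subr0; apply: le_lt_trans (Ht i) _.
  by rewrite ltr_pwDr// ler_norm.
by rewrite lebesgueN_cube// ltry.
Qed.

Lemma integrable_ispoly D f : tame D -> ispoly f ->
  (lebesgueN R n).-integrable (preT D) (EFin \o (f \o @rV_of R n)).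
Proof.
move=> tD pf; have [mD [B HB]] := tD; apply: measurable_bounded_integrable => //.
- exact: tame_fin_measure.
- by apply: measurable_funTS; exact: measurable_ispoly.
have [C fC] := bounded_ispoly B pf.
exists C; split; first exact: num_real.
move=> c cC t Dt; apply: le_trans (ltW cC); apply: fC; exact: HB.
Qed.

Lemma tame_cube (c : 'rV[R]_n) l : tame (cube c l).
Proof.
split; first exact: measurable_cube.
exists (\sum_i `|c 0 i| + l) => x cx i.
have := cx i; have : `|c 0 i| <= \sum_i `|c 0 i|.
  by rewrite (bigD1 i)//= lerDl sumr_ge0.
have := ler_normD (x 0 i - c 0 i) (c 0 i); rewrite subrK; lra.
Qed.

Lemma eq_vint D f g : (forall x, D x -> f x = g x) -> vint D f = vint D g.
Proof. by move=> fg; apply: eq_Rintegral => t /[!inE] /fg. Qed.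

Lemma vintD D f g : tame D -> ispoly f -> ispoly g ->
  vint D (fun x => f x + g x) = vint D f + vint D g.
Proof. by move=> tD pf pg; apply: RintegralD; [case: tD|exact: integrable_ispoly..]. Qed.

Lemma vintB D f g : tame D -> ispoly f -> ispoly g ->
  vint D (fun x => f x - g x) = vint D f - vint D g.
Proof. by move=> tD pf pg; apply: RintegralB; [case: tD|exact: integrable_ispoly..]. Qed.

Lemma vintZ D a f : tame D -> ispoly f -> vint D (fun x => a * f x) = a * vint D f.
Proof. by move=> tD pf; apply: RintegralZl; [case: tD|exact: integrable_ispoly..]. Qed.

Lemma vint0 D : vint D (fun=> 0) = 0 :> R.
Proof. by rewrite /vint /Rintegral integral0. Qed.

Lemma vint_sum D (I : Type) (r : seq I) (P : pred I) (F : I -> 'rV[R]_n -> R) :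
  tame D -> (forall i, P i -> ispoly (F i)) ->
  vint D (fun x => \sum_(i <- r | P i) F i x) = \sum_(i <- r | P i) vint D (F i).
Proof.
move=> tD pF; elim: r => [|i r IH].
  by under eq_fun do rewrite big_nil; rewrite big_nil vint0.
under eq_fun do rewrite big_cons; rewrite big_cons.
have [Pi|//] := ifP; rewrite vintD ?IH//; first exact: pF.
exact: ispoly_sum.
Qed.

Lemma vint_ge0 D f : (forall x, D x -> 0 <= f x) -> 0 <= vint D f.
Proof. by move=> f0; apply: Rintegral_ge0 => t; exact: f0. Qed.

Lemma le_vint D f g : tame D -> ispoly f -> ispoly g ->
  (forall x, D x -> f x <= g x) -> vint D f <= vint D g.
Proof.
move=> tD pf pg fg; apply: le_Rintegral; [by case: tD|exact: integrable_ispoly..|].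
by move=> t; exact: fg.
Qed.

Lemma vint_cst D (a : R) : tame D -> vint D (fun=> a) = a * vint D (fun=> 1).
Proof.
by move=> tD; rewrite -vintZ//; [apply: eq_vint => x _; rewrite mulr1|exact: ispoly_cst].
Qed.

Lemma vint_cube1 (c : 'rV[R]_n) l : 0 < l -> vint (cube c l) (fun=> 1) = (2 * l) ^+ n.
Proof.
move=> l0; rewrite /vint Rintegral_cst; last exact: measurable_cube.
by rewrite mul1r [X in fine X](lebesgueN_cube _ l0).
Qed.

Lemma vint_EFin D f : tame D -> ispoly f ->
  (vint D f)%:E = (\int[lebesgueN R n]_(t in preT D) (f (rV_of t))%:E)%E.
Proof.
move=> tD pf; rewrite fineK//; have := integrable_ispoly tD pf.
by move=> /integrable_fin_num; apply; case: tD.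
Qed.

Lemma sum_vint_le (I : finType) (P : pred I) (Q : I -> set 'rV[R]_n) D f :
  tame D -> ispoly f -> (forall x, D x -> 0 <= f x) ->
  (forall i, P i -> measurable (preT (Q i)) /\ Q i `<=` D) ->
  (forall i j, P i -> P j -> i != j -> Q i `&` Q j = set0) ->
  \sum_(i | P i) vint (Q i) f <= vint D f.
Proof.
move=> tD pf f0 QP Qdis.
have tQ i : P i -> tame (Q i).
  move=> Pi; have [mQ QD] := QP _ Pi; split=> //.
  by have [_ [B HB]] := tD; exists B => x /QD /HB.
rewrite -lee_fin -sumEFin vint_EFin//.
(* Outside [P] the sets [Q i] are replaced by the empty set, to get a family that is measurable for
   every index. *)
rewrite (eq_bigr (fun i => \int[lebesgueN R n]_(t in if P i then preT (Q i) else set0)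
    (f (rV_of t))%:E)%E); last first.
  by move=> i Pi; rewrite Pi vint_EFin//; exact: tQ.
rewrite -big_filter.
have mf : measurable_fun setT (fun t : n.-tuple X => (f (rV_of t))%:E).
  by apply/measurable_EFinP; exact: measurable_ispoly.
rewrite -ge0_integral_bigsetU.
- apply: ge0_subset_integral.
  + apply: bigsetU_measurable => i _; case: ifP => // Pi.
    by have [] := QP _ Pi.
  + by case: tD.
  + exact: measurable_funTS.
  + by move=> t Dt; rewrite lee_fin f0.
  + move=> t; rewrite -bigcup_seq => -[i _]; case: ifP => //= Pi.
    by have [_] := QP _ Pi; exact.
- by move=> i; case: ifP => // Pi; have [] := QP _ Pi.
- by rewrite filter_uniq// index_enum_uniq.
- apply/trivIsetP => i j; rewrite /= !mem_filter => /andP[Pi _] /andP[Pj _] ij.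
  rewrite Pi Pj; apply/seteqP; split => // t -[/= Qi Qj].
  by have /seteqP[/(_ (rV_of t)) H _] := Qdis _ _ Pi Pj ij; exact: H.
- exact: measurable_funTS.
move=> t; rewrite -bigcup_seq => -[i _]; case: ifP => //= Pi Qt.
by rewrite lee_fin f0//; have [_] := QP _ Pi; exact.
Qed.

Lemma vint_subset D D' f : tame D' -> measurable (preT D) -> ispoly f ->
  (forall x, D' x -> 0 <= f x) -> D `<=` D' -> vint D f <= vint D' f.
Proof.
move=> tD mD pf f0 DD.
have := @sum_vint_le unit predT (fun=> D) D' f tD pf f0.
by rewrite (big_pred1 tt) => [|[]//]; apply => // -[] [].
Qed.

End Vint.

(** * Pointwise bound of a polynomial by its mean square over a cube *)

Section SupBound.
Variables (R : realType) (n m : nat).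
Local Notation X := (measurableTypeR R).

Lemma sqr_sum_le (I : finType) (w y : I -> R) :
  (\sum_i w i * y i) ^+ 2 <= (\sum_i w i ^+ 2) * \sum_i y i ^+ 2.
Proof.
set W := \sum_i w i ^+ 2; set Y := \sum_i y i ^+ 2; set S := \sum_i _.
have W0 : 0 <= W by apply: sumr_ge0 => i _; exact: sqr_ge0.
have H (a b : R) : 2 * a * b * S <= a ^+ 2 * W + b ^+ 2 * Y.
  rewrite !mulr_sumr -big_split/=; apply: ler_sum => i _.
  by have := sqr_ge0 (a * w i - b * y i); nra.
have [W0'|Wp] := eqVneq W 0.
  have w0 i : w i = 0.
    apply/eqP; rewrite -sqrf_eq0; move: W0'; rewrite /W => /eqP.
    by rewrite psumr_eq0 => [/allP/(_ i (mem_index_enum _))|j _]; [|exact: sqr_ge0].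
  by rewrite W0' mul0r /S big1 ?expr0n// => i _; rewrite w0 mul0r.
have W1 : 0 < W by rewrite lt0r Wp.
(* The choice [a = S], [b = W] gives [W S^2 <= W^2 Y], to be divided by [W]. *)
by have := H S W; nra.
Qed.

(* [f x] is extrapolated, by Lagrange, from the values of [f] at the points
   [x + s (z - x)] for finitely many [s] in [[1/2, 1]]; averaging over the [z] in a
   small cube gives the bound. *)
Lemma polyfun_sup_bound (rho : R) : 0 <= rho -> exists2 C : R, 0 < C &
  forall (f : 'rV[R]_n -> R) (c x : 'rV[R]_n) (l : R), polyfun m f -> 0 < l ->
    (forall i, `|x 0 i - c 0 i| <= rho * l) ->
    f x ^+ 2 * l ^+ n <= C * vint (cube c l) (fun z => f z ^+ 2).
Proof.
move=> rho0.
(* The spacing keeps all nodes so close to 1 that moving a point [z] of the half-size cube to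
   [x + s j (z - x)] costs at most [l / 2], since each coordinate of [z - x] is at most
   [(rho + 1) l]. The moved point thus stays in [cube c l]. *)
pose del : R := (2 * m.+1%:R * (rho + 1))^-1.
have del0 : 0 < del by rewrite invr_gt0 !mulr_gt0// ltr_wpDl.
pose s (j : nat) : R := 1 - j%:R * del.
have s_inj : injective s.
  move=> i j /addrI/oppr_inj/(mulIf (lt0r_neq0 del0))/eqP.
  by rewrite eqr_nat => /eqP.
have s1 j : s j <= 1 by rewrite gerBl mulr_ge0// ltW.
have sdel (j : 'I_m.+1) : (1 - s j) * (rho + 1) <= 2^-1.
  rewrite /s opprB addrCA subrr addr0 /del.
  have jm : (j%:R : R) <= m.+1%:R by rewrite ler_nat ltnW.
  rewrite (_ : j%:R * _ * _ = j%:R / m.+1%:R / 2); last first.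
    by field; rewrite ?pnatr_eq0 ?lt0r_neq0// ltr_wpDl.
  by rewrite ler_piMl// ler_pdivrMr// mul1r.
have s2 (j : 'I_m.+1) : 2^-1 <= s j.
  have := sdel j; have := s1 j => ? ?.
  have : (1 - s j) * 1 <= (1 - s j) * (rho + 1) by rewrite ler_wpM2l ?lerDr// subr_ge0.
  lra.
pose w (j : 'I_m.+1) : R := (tnth (lagrange m.+1 s) j : {poly R}).[0].
pose W : R := \sum_j w j ^+ 2 + 1.
have W0 : 0 < W by rewrite ltr_wpDl// sumr_ge0// => j _; exact: sqr_ge0.
(* [W] comes from Cauchy-Schwarz on the Lagrange weights at 0, [m.+1] from the number of nodes, and
   [2 ^+ n] bounds the inverse Jacobians [s j ^- n] because [s j >= 1/2]. *)
exists (W * (m.+1%:R * 2 ^+ n)); first by rewrite !mulr_gt0// exprn_gt0.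
move=> f c x l pf l0 xc.
have pf2 : ispoly (fun z => f z ^+ 2) by apply: ispolyX; exists m.
pose g (z : 'rV[R]_n) : R := f z ^+ 2 * (z \in cube c l)%:R.
pose G (t : n.-tuple X) : \bar R := (g (rV_of t))%:E.
have G0 t : (0 <= G t)%E by rewrite lee_fin mulr_ge0// sqr_ge0.
have mG : measurable_fun setT G.
  apply/measurable_EFinP; apply: measurable_funM; first exact: (measurable_ispoly pf2).
  rewrite (_ : (fun _ => _) = \1_(preT (cube c l))); last first.
    by apply/funext => t; rewrite indicE; congr (_%:R); apply/idP/idP; rewrite !inE.
  by apply: measurable_indic; exact: measurable_cube.
have intG : (\int[lebesgueN R n]_t G t = (vint (cube c l) (fun z => f z ^+ 2))%:E)%E.
  rewrite vint_EFin//; last exact: tame_cube.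
  rewrite [RHS]integral_mkcond; apply: eq_integral => t _; rewrite /G /g patchE.
  have -> : (t \in preT (cube c l)) = (rV_of t \in cube c l) by apply/idP/idP; rewrite !inE.
  by case: ifP => _; rewrite ?mulr1 ?mulr0.
pose a (j : 'I_m.+1) : n.-tuple X := [tuple (1 - s j) * x 0 i | i < n].
pose A (j : 'I_m.+1) (t : n.-tuple X) : n.-tuple X := afft (a j) (s j) t.
have AE j t : rV_of (A j t) = x + s j *: (rV_of t - x).
  by apply/rowP => i; rewrite !mxE !tnth_mktuple; ring.
have mGA j : measurable_fun setT (G \o A j).
  by apply: measurableT_comp => //; exact: measurable_afft.
have l2 : 0 < l / 2 by rewrite divr_gt0.
have mc : measurable (preT (cube c (l / 2))) by exact: measurable_cube.
have key t : preT (cube c (l / 2)) t ->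
    ((f x ^+ 2)%:E <= W%:E * \sum_(j < m.+1) G (A j t))%E.
  move=> ct; have [q sq fq] := polyfun_line x (rV_of t - x) pf.
  have inc j : rV_of (A j t) \in cube c l.
    rewrite inE AE => i; have := ct i; have := xc i; rewrite !mxE.
    set y := tnth t i; set x0 := x 0 i; set c0 := c 0 i => h1 h2.
    have : `|(1 - s j) * (x0 - y)| <= 2^-1 * l.
      have sj0 : 0 <= 1 - s j by rewrite subr_ge0.
      rewrite normrM (ger0_norm sj0).
      have : `|x0 - y| <= (rho + 1) * l.
        have := ler_normB (x0 - c0) (y - c0); rewrite opprB addrA subrK.
        move: h1 h2; lra.
      move=> /(ler_wpM2l sj0) /le_trans; apply.
      by rewrite mulrA; apply: ler_wpM2r; [exact: ltW|exact: sdel].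
    move=> h3; rewrite (_ : x0 + _ - c0 = (y - c0) + (1 - s j) * (x0 - y)); last by ring.
    apply: le_lt_trans (ler_normD _ _) _.
    move: h2 h3; lra.
  have fx : f x = \sum_(j < m.+1) w j * f (rV_of (A j t)).
    have := fq 0; rewrite scale0r addr0 => ->.
    rewrite {1}(lagrange_gen (ltn0Sn m) s_inj sq) horner_sum.
    by apply: eq_bigr => j _; rewrite hornerM hornerC AE fq mulrC.
  under eq_bigr => j _ do rewrite /G /g inc mulr1.
  rewrite sumEFin -EFinM lee_fin fx.
  apply: le_trans (sqr_sum_le _ _) _; rewrite ler_wpM2r//.
    by apply: sumr_ge0 => j _; exact: sqr_ge0.
  by rewrite lerDl.
rewrite -lee_fin [leRHS]EFinM -intG.
(* The cube of half-width [l / 2] has volume exactly [l ^+ n]. *)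
apply: le_trans (_ : (_ <= \int[lebesgueN R n]_(t in preT (cube c (l / 2))) (f x ^+ 2)%:E)%E) _.
  rewrite integral_cst// [X in (_ * X)%E](lebesgueN_cube _ l2) -EFinM lee_fin.
  by rewrite [2 * (l / 2)]mulrC divfK.
have mS : measurable_fun setT (fun t => \sum_(j < m.+1) G (A j t))%E.
  by apply: emeasurable_sum => j; exact: mGA.
apply: le_trans (_ : (_ <= \int[lebesgueN R n]_t (W%:E * \sum_(j < m.+1) G (A j t)))%E) _.
  apply: le_trans (_ : (_ <= \int[lebesgueN R n]_(t in preT (cube c (l / 2)))
      (W%:E * \sum_(j < m.+1) G (A j t)))%E) _.
    apply: ge0_le_integral => //.
    - by move=> t _; rewrite lee_fin sqr_ge0.
    - by apply: measurable_funTS; exact: measurable_funeM.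
  apply: ge0_subset_integral => //; first exact: measurable_funeM.
  by move=> t _; rewrite mule_ge0// ?lee_fin ?(ltW W0)// sume_ge0.
rewrite ge0_integralZl//; last 2 first.
- by move=> t _; rewrite sume_ge0.
- by rewrite lee_fin ltW.
rewrite EFinM -muleA lee_pmul2l// ge0_integral_sum//.
rewrite EFinM -muleA.
apply: le_trans (_ : (_ <= \sum_(j < m.+1) ((2 ^+ n)%:E * \int[lebesgueN R n]_t G t))%E) _.
  apply: lee_sum => j _; have sj0 : 0 < s j by apply: lt_le_trans (s2 j).
  rewrite -(@ge0_integral_affine R n G (a j) (s j))// muleA -EFinM -exprMn.
  rewrite -[leLHS]mul1e; apply: lee_wpmul2r; first exact: integral_ge0.
  by rewrite lee_fin exprn_ege1//; have := s2 j; lra.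
by rewrite intG -!EFinM sumEFin lee_fin sumr_const card_ord mulr_natl.
Qed.

End SupBound.

(** * Euclidean norm, balls, diameters and polytopes *)

Section Euclidean.
Variable R : realType.

Lemma ipE m n (A B : 'M[R]_(m, n)) : ip A B = \sum_i \sum_j A i j * B i j.
Proof.
rewrite /ip /mxtrace; apply: eq_bigr => i _; rewrite mxE.
by apply: eq_bigr => j _; rewrite mxE.
Qed.

Lemma ip_rV n (x y : 'rV[R]_n) : ip x y = \sum_j x 0 j * y 0 j.
Proof. by rewrite ipE big_ord1. Qed.

Lemma ipC m n (A B : 'M[R]_(m, n)) : ip A B = ip B A.
Proof. by rewrite /ip -mxtrace_tr trmx_mul trmxK. Qed.

Lemma ipDl m n (A B C : 'M[R]_(m, n)) : ip (A + B) C = ip A C + ip B C.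
Proof. by rewrite /ip mulmxDl mxtraceD. Qed.

Lemma ipZl m n a (A B : 'M[R]_(m, n)) : ip (a *: A) B = a * ip A B.
Proof. by rewrite /ip -scalemxAl mxtraceZ. Qed.

Lemma ipNl m n (A B : 'M[R]_(m, n)) : ip (- A) B = - ip A B.
Proof. by rewrite -scaleN1r ipZl mulN1r. Qed.

Lemma ipBl m n (A B C : 'M[R]_(m, n)) : ip (A - B) C = ip A C - ip B C.
Proof. by rewrite ipDl ipNl. Qed.

Lemma ip0l m n (A : 'M[R]_(m, n)) : ip 0 A = 0.
Proof. by rewrite /ip mul0mx mxtrace0. Qed.

Lemma ipDr m n (A B C : 'M[R]_(m, n)) : ip C (A + B) = ip C A + ip C B.
Proof. by rewrite ipC ipDl !(ipC C). Qed.

Lemma ipZr m n a (A B : 'M[R]_(m, n)) : ip A (a *: B) = a * ip A B.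
Proof. by rewrite ipC ipZl ipC. Qed.

Lemma ipNr m n (A B : 'M[R]_(m, n)) : ip A (- B) = - ip A B.
Proof. by rewrite ipC ipNl ipC. Qed.

Lemma ipBr m n (A B C : 'M[R]_(m, n)) : ip C (A - B) = ip C A - ip C B.
Proof. by rewrite ipDr ipNr. Qed.

Lemma ip_suml m n (I : Type) (r : seq I) (P : pred I) (F : I -> 'M[R]_(m, n)) B :
  ip (\sum_(i <- r | P i) F i) B = \sum_(i <- r | P i) ip (F i) B.
Proof. exact: (big_morph (fun A => ip A B) (fun A C => ipDl A C B) (ip0l B)). Qed.

Lemma ip_ge0 m n (A : 'M[R]_(m, n)) : 0 <= ip A A.
Proof.
by rewrite ipE; apply: sumr_ge0 => i _; apply: sumr_ge0 => j _; rewrite -expr2 sqr_ge0.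
Qed.

Lemma enorm_sqr m n (A : 'M[R]_(m, n)) : enorm A ^+ 2 = ip A A.
Proof. by rewrite sqr_sqrtr// ip_ge0. Qed.

Lemma enorm_ge0 m n (A : 'M[R]_(m, n)) : 0 <= enorm A.
Proof. exact: sqrtr_ge0. Qed.

Lemma ip_entry m n (A : 'M[R]_(m, n)) i j : A i j ^+ 2 <= ip A A.
Proof.
rewrite ipE (bigD1 i)//= (bigD1 j)//= -expr2 -addrA lerDl addr_ge0//.
  by apply: sumr_ge0 => l _; rewrite -expr2 sqr_ge0.
by apply: sumr_ge0 => k _; apply: sumr_ge0 => l _; rewrite -expr2 sqr_ge0.
Qed.

Lemma entry_le_enorm m n (A : 'M[R]_(m, n)) i j : `|A i j| <= enorm A.
Proof. by rewrite -sqrtr_sqr ler_wsqrtr// ip_entry. Qed.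

Lemma ip_CS m n (A B : 'M[R]_(m, n)) : ip A B ^+ 2 <= ip A A * ip B B.
Proof.
rewrite !ipE !pair_bigA/=; under [X in _ <= X * _]eq_bigr do rewrite -expr2.
under [X in _ <= _ * X]eq_bigr do rewrite -expr2.
exact: sqr_sum_le.
Qed.

Lemma ip_young m n (A B : 'M[R]_(m, n)) (s : R) : 0 < s ->
  ip A B <= s / 2 * ip A A + (2 * s)^-1 * ip B B.
Proof.
move=> s0; have := ip_ge0 (s *: A - B); rewrite ipBl !ipBr !ipZl !ipZr (ipC B A).
set a := ip A A; set b := ip B B; set c := ip A B => h.
rewrite -(ler_pM2l (_ : 0 < 2 * s)) ?mulr_gt0// mulrDr mulrA mulVKf; last first.
  by rewrite mulf_neq0// ?pnatr_eq0// lt0r_neq0.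
lra.
Qed.

Lemma ip_sqrD m n (A B : 'M[R]_(m, n)) : ip (A + B) (A + B) <= 2 * ip A A + 2 * ip B B.
Proof.
have := ip_ge0 (A - B); rewrite ipBl !ipBr ipDl !ipDr (ipC B A); lra.
Qed.

Lemma enorm_le n (x : 'rV[R]_n) (b : R) : 0 <= b -> (forall i, `|x 0 i| <= b) ->
  enorm x <= n%:R * b.
Proof.
move=> b0 xb; rewrite -(ler_pXn2r (_ : (0 < 2)%N))// ?nnegrE ?enorm_ge0 ?mulr_ge0//.
rewrite enorm_sqr ip_rV; apply: le_trans (_ : _ <= \sum_(j < n) b ^+ 2) _.
  apply: ler_sum => j _; rewrite -expr2 -real_normK ?num_real//.
  by rewrite lerXn2r ?nnegrE.
rewrite sumr_const card_ord exprMn -[leLHS]mulr_natl ler_wpM2r ?sqr_ge0//.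
by rewrite -natrX ler_nat -mulnn; case: (n) => // j; rewrite leq_pmull.
Qed.

(** The Euclidean norm is at most [n] times the sup norm; dividing by [n.+1] makes the inequality
    strict in every dimension. *)
Lemma cube_eball n (c : 'rV[R]_n) r : 0 < r -> cube c (r / n.+1%:R) `<=` eball c r.
Proof.
move=> r0 x cx; have b0 : 0 <= r / n.+1%:R by rewrite divr_ge0// ltW.
apply: le_lt_trans (@enorm_le n (x - c) (r / n.+1%:R) b0 _) _.
  by move=> i; rewrite !mxE ltW.
rewrite mulrCA gtr_pMr// ltr_pdivrMr// mul1r ltr_nat//.
Qed.

Lemma open_cube n (c : 'rV[R]_n) l : 0 < l -> open (cube c l).
Proof.
move=> l0; rewrite (_ : cube c l = ball c l); first exact: ball_open.
apply/seteqP; split => [x cx|x [_ h] i].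
  by split => // i j; rewrite ord1 /ball/= distrC; exact: cx.
by have := h 0 i; rewrite /ball/= distrC.
Qed.

Lemma enormD m n (A B : 'M[R]_(m, n)) : enorm (A + B) <= enorm A + enorm B.
Proof.
rewrite -(ler_pXn2r (_ : (0 < 2)%N))// ?nnegrE ?enorm_ge0 ?addr_ge0 ?enorm_ge0//.
rewrite sqrrD !enorm_sqr ipDl !ipDr (ipC B A).
have : ip A B <= enorm A * enorm B.
  apply: le_trans (ler_norm _) _; rewrite -sqrtr_sqr /enorm -sqrtrM ?ip_ge0//.
  by rewrite ler_wsqrtr// ip_CS.
lra.
Qed.

Lemma eball_interior n (c : 'rV[R]_n) r D : eball c r `<=` D ->
  forall x, eball c r x -> D° x.
Proof.
move=> cD x cx; have {cx} cx : 0 < r - enorm (x - c) by rewrite subr_gt0.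
rewrite /interior; apply/nbhs_ballP; exists ((r - enorm (x - c)) / n.+1%:R) => /=.
  by rewrite divr_gt0.
move=> y [e0 xy]; apply: cD; rewrite /eball/= -(subrK x y) -addrA.
apply: le_lt_trans (enormD _ _) _.
have := @enorm_le n (y - x) _ (ltW e0) _; rewrite mulrCA => h.
rewrite -ltrBrDr; apply: le_lt_trans (h _) _.
  by move=> i; have := xy 0 i; rewrite /ball/= !mxE distrC => /ltW.
by rewrite gtr_pMr// ltr_pdivrMr// mul1r ltr_nat.
Qed.

(** Boundedness ensures that the [sup] in [diam] is a genuine supremum and not a default value. *)
Lemma diam_ge n (D : set 'rV[R]_n) x y : (exists B : R, forall x, D x -> forall i, `|x 0 i| <= B) ->
  D x -> D y -> enorm (x - y) <= diam D.
Proof.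
move=> [B HB] Dx Dy; apply: ub_le_sup; last by exists x, y.
exists (n%:R * (`|B| + `|B|)) => _ [u [v [Du Dv ->]]].
apply: enorm_le; first by rewrite addr_ge0.
move=> i; rewrite !mxE; apply: le_trans (ler_normB _ _) _.
by apply: lerD; [apply: le_trans (HB _ Du i) _|apply: le_trans (HB _ Dv i) _]; exact: ler_norm.
Qed.

Lemma closed_tame n (D : set 'rV[R]_n) : closed D ->
  (exists B : R, forall x, D x -> forall i, `|x 0 i| <= B) -> tame D.
Proof.
move=> cD bD; split=> //; rewrite (_ : preT D = ~` preT (~` D)).
  by apply: measurableC; apply: open_measurable_preT; exact: closed_openC.
by apply/seteqP; split => t /= h; [move=> nh; exact: nh h|exact: contrapT].
Qed.

Lemma compact_tame n (D : set 'rV[R]_n) : compact D ->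
  (exists B : R, forall x, D x -> forall i, `|x 0 i| <= B) -> tame D.
Proof. by move=> /compact_closed cD; apply: closed_tame; apply: cD; exact: norm_hausdorff. Qed.

Lemma polytope_bounded n (D : set 'rV[R]_n) : polytope D ->
  exists B : R, forall x, D x -> forall i, `|x 0 i| <= B.
Proof.
move=> [[ss ->] _ _].
(* The weights of a convex combination are at most 1, so the sum of all coordinates of all vertices
   is a bound. *)
exists (\sum_(s <- ss) \sum_(v <- s) \sum_i `|v 0 i|) => x [s /= sss [w [w0 w1 ->]]] i.
apply: le_trans (_ : \sum_(v <- s) \sum_i `|v 0 i| <= _); last first.
  rewrite (big_rem s)//= lerDl sumr_ge0// => s' _.
  by apply: sumr_ge0 => v _; apply: sumr_ge0.
rewrite summxE; apply: le_trans (ler_norm_sum _ _ _) _.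
rewrite (big_nth 0) big_mkord; apply: ler_sum => j _; rewrite mxE normrM (ger0_norm (w0 j)).
have wj : w j <= 1 by rewrite -w1 (bigD1 j)//= lerDl sumr_ge0.
apply: le_trans (_ : _ <= `|s`_j 0 i|) _; first by rewrite ler_piMl.
by rewrite (bigD1 i)//= lerDl sumr_ge0.
Qed.

Lemma polytope_closed n (D : set 'rV[R]_n) : polytope D -> closed D.
Proof. by move=> [_ -> _]; exact: closed_closure. Qed.

Lemma polytope_tame n (D : set 'rV[R]_n) : polytope D -> tame D.
Proof.
by move=> pD; apply: closed_tame; [exact: polytope_closed|exact: polytope_bounded].
Qed.

Lemma polytope_compact n (D : set 'rV[R]_n) : polytope D -> compact D.
Proof.
move=> pD; apply: bounded_closed_compact; last exact: polytope_closed.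
have [B HB] := polytope_bounded pD; exists `|B|; split; first exact: num_real.
move=> M BM x Dx; have M0 : 0 <= M by apply: le_trans (ltW BM).
rewrite /= -[`|x|]/(mx_norm x) mx_normrE; apply/bigmax_leP; split=> // -[i j] _ /=.
by rewrite ord1; apply: le_trans (HB _ Dx j) _; apply: le_trans (ler_norm _) (ltW BM).
Qed.

End Euclidean.

(** * Orthonormal frame of a face and extension along its normal *)

Section Frames.
Variables (R : realType) (d : nat) (F : facet R d.+1).
Hypothesis wfF : facet_wf F.
Implicit Types x : 'rV[R]_d.+1.

Let fr : 'M[R]_(d, d.+1) := fframe F.
Let nu : 'rV[R]_d.+1 := fnrm F.

Lemma nrm_ip1 : ip nu nu = 1. Proof. by case: wfF. Qed.

Lemma frame_nrm (y : 'rV[R]_d) : ip (y *m fr) nu = 0.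
Proof. by case: wfF => _ _ h _; rewrite /ip -mulmxA h mulmx0 mxtrace0. Qed.

(** The normal and the frame are the rows of a square matrix [W] with [W W^T = 1], so [W^T W = 1] as
    well. *)
Lemma frame_complete : nu^T *m nu + fr^T *m fr = 1%:M.
Proof.
have [_ h1 h2 h3] := wfF.
pose W : 'M[R]_(1 + d, d.+1) := col_mx nu fr.
have nn : nu *m nu^T = 1%:M.
  apply/matrixP => i j; rewrite !ord1; move: h3; rewrite /ip /mxtrace big_ord1 => ->.
  by rewrite mxE eqxx.
have WW : @mulmx R (1 + d) d.+1 (1 + d) W W^T = 1%:M.
  rewrite /W tr_col_mx mul_col_row nn h1 h2.
  have -> : nu *m fr^T = 0 by apply: trmx_inj; rewrite trmx_mul trmxK h2 trmx0.
  by rewrite -scalar_mx_block.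
have := @mulmx1C R d.+1 W W^T WW; rewrite /W tr_col_mx => <-.
by rewrite [RHS](mul_row_col nu^T fr^T nu fr).
Qed.

Lemma frame_decomp x : x = ip x nu *: nu + x *m fr^T *m fr.
Proof.
rewrite -[LHS]mulmx1 -frame_complete mulmxDr !mulmxA; congr (_ + _).
rewrite -mul_scalar_mx; congr (_ *m _); apply/matrixP => i j.
by rewrite !ord1 /ip /mxtrace big_ord1 [RHS]mxE eqxx mulr1n.
Qed.

Lemma frame_ip x : ip (x *m fr^T) (x *m fr^T) <= ip x x.
Proof.
rewrite {3}(frame_decomp x) ipDl ipZl -{2}[x]mulmx1 [ip nu _]ipC.
have -> : ip (x *m fr^T *m fr) x = ip (x *m fr^T) (x *m fr^T).
  by rewrite /ip trmx_mul trmxK mulmxA.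
by rewrite mulmx1 lerDr -expr2 sqr_ge0.
Qed.

Lemma frame_enorm x : enorm (x *m fr^T) <= enorm x.
Proof. by rewrite ler_wsqrtr// frame_ip. Qed.

Lemma frame_isom (y : 'rV[R]_d) : ip (y *m fr) (y *m fr) = ip y y.
Proof. by have [_ h1 _ _] := wfF; rewrite /ip trmx_mul mulmxA -[y *m fr *m _]mulmxA h1 mulmx1. Qed.

Lemma frameK (y : 'rV[R]_d) : y *m fr *m fr^T = y.
Proof. by have [_ h1 _ _] := wfF; rewrite -mulmxA h1 mulmx1. Qed.

(** In the coordinates of the face, the extension is evaluation at the orthogonal projection; this
    is the form used in [extension_bound]. *)
Lemma fextE T (v : 'rV[R]_d.+1 -> T) x : fext F v x = v (Defs.fmap F ((x - forig F) *m fr^T)).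
Proof.
rewrite /fext /Defs.fmap; congr (v _); rewrite -/nu -/fr.
rewrite -[LHS](subrK (forig F)) [RHS]addrC; congr (_ + _).
by rewrite addrAC {1}(frame_decomp (x - forig F)) addrC addKr.
Qed.

Lemma fmap_hyperplane y : ip (Defs.fmap F y - forig F) nu = 0.
Proof. by rewrite /Defs.fmap addrAC subrr add0r frame_nrm. Qed.

Lemma fext_fset T (v : 'rV[R]_d.+1 -> T) x : fset_of F x -> fext F v x = v x.
Proof.
by move=> [y _ <-]; rewrite /fext fmap_hyperplane scale0r subr0.
Qed.

End Frames.

(** * Norm equivalences for polynomials *)

Section PolynomialNorms.
Variable R : realType.

Lemma poly_norm_equiv n m (rho : R) : 0 <= rho -> exists2 C : R, 0 < C &
  forall (D : set 'rV[R]_n) (f : 'rV[R]_n -> R) c r, tame D -> polyfun m f -> 0 < r ->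
    eball c r `<=` D -> diam D <= rho * r ->
    vint D (fun x => f x ^+ 2) <= C * vint (cube c (r / n.+1%:R)) (fun x => f x ^+ 2).
Proof.
move=> rho0; have N0 : 0 < n.+1%:R :> R by [].
have rhoN : 0 <= rho * n.+1%:R by rewrite mulr_ge0.
have [C C0 HC] := @polyfun_sup_bound R n m _ rhoN.
(* The second factor is the ratio of the volumes of the cubes of half-widths [(rho + 1) r], which
   contains [D], and [r / n.+1]. Adding 1 to [rho] leaves room for the strict inequality in
   [cube]. *)
exists (C * (2 * (rho + 1) * n.+1%:R) ^+ n) => [|D f c r tD pf r0 cD dD].
  by rewrite mulr_gt0// exprn_gt0// !mulr_gt0// ltr_wpDl.
set l := r / n.+1%:R; set I := vint (cube c l) _.
have l0 : 0 < l by rewrite divr_gt0.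
have rl : r = n.+1%:R * l by rewrite /l mulrC divfK.
have pf2 : ispoly (fun x => f x ^+ 2) by apply: ispolyX; exists m.
have Dc : D c by apply: cD; rewrite /eball/= subrr /enorm ip0l sqrtr0.
have xc x i : D x -> `|x 0 i - c 0 i| <= rho * r.
  move=> Dx; have := entry_le_enorm (x - c) 0 i; rewrite !mxE => /le_trans; apply.
  by apply: le_trans dD; apply: diam_ge => //; case: tD.
have ln : 0 < l ^+ n by rewrite exprn_gt0.
have fle x : D x -> f x ^+ 2 <= C * I / l ^+ n.
  move=> Dx; rewrite ler_pdivlMr//; apply: HC => // i.
  by rewrite -mulrA -rl xc.
have I0 : 0 <= I by apply: vint_ge0 => x _; exact: sqr_ge0.
have R0 : 0 < (rho + 1) * r by rewrite mulr_gt0// ltr_wpDl.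
apply: le_trans (_ : _ <= C * I / l ^+ n * (2 * ((rho + 1) * r)) ^+ n) _.
  apply: le_trans (_ : _ <= vint D (fun=> C * I / l ^+ n)) _.
    by apply: le_vint => //; exact: ispoly_cst.
  rewrite vint_cst// -(vint_cube1 c R0) ler_wpM2l//.
    by apply: divr_ge0; [exact: mulr_ge0 (ltW C0) I0|exact: ltW].
  apply: vint_subset; [exact: tame_cube|by case: tD|exact: ispoly_cst|by move=> *; exact: ler01|].
  move=> x Dx i; apply: le_lt_trans (xc _ i Dx) _.
  by rewrite ltr_pM2r// ltrDl.
have -> : 2 * ((rho + 1) * r) = 2 * (rho + 1) * n.+1%:R * l by rewrite {1}rl !mulrA.
rewrite [(_ * l) ^+ n]exprMn; set S := (2 * _ * _) ^+ n; set P := l ^+ n.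
by rewrite (_ : C * I / P * (S * P) = C * S * I)//; field; exact: lt0r_neq0.
Qed.

(* [x |-> q ((x - forig F) *m (fframe F)^T)] is the extension from [F], constant along
   the normal, of the function given by [q] in the coordinates of the face. *)
Lemma extension_bound d m (rho : R) : 0 <= rho -> exists2 C : R, 0 < C &
  forall (F : facet R d.+1) (T : set 'rV[R]_d.+1) (q : 'rV[R]_d -> R) c y0 r,
    tame T -> tame (fbase F) -> polyfun m q ->
    ispoly (fun x => q ((x - forig F) *m (fframe F)^T)) -> 0 < r ->
    eball y0 r `<=` fbase F -> T `<=` cube c ((rho + 1) * r) ->
    (forall x, T x -> forall i, `|((x - forig F) *m (fframe F)^T) 0 i - y0 0 i| <= rho * r) ->
    vint T (fun x => q ((x - forig F) *m (fframe F)^T) ^+ 2) <=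
      C * r * vint (fbase F) (fun y => q y ^+ 2).
Proof.
move=> rho0; have N0 : 0 < d.+1%:R :> R by [].
have rhoN : 0 <= rho * d.+1%:R by rewrite mulr_ge0.
have [C C0 HC] := @polyfun_sup_bound R d m _ rhoN.
exists (C * (2 * (rho + 1)) ^+ d.+1 * d.+1%:R ^+ d).
  by rewrite !mulr_gt0// exprn_gt0// !mulr_gt0// ltr_wpDl.
move=> F T q c y0 r tT tF pq pqe r0 yF Tc Ty.
set l := r / d.+1%:R; set J := vint (fbase F) _.
have l0 : 0 < l by rewrite divr_gt0.
have rl : r = d.+1%:R * l by rewrite /l mulrC divfK.
have pq2 : ispoly (fun x => q x ^+ 2) by apply: ispolyX; exists m.
have ln : 0 < l ^+ d by rewrite exprn_gt0.
have IJ : vint (cube y0 l) (fun y => q y ^+ 2) <= J.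
  apply: vint_subset => //; first exact: measurable_cube.
    by move=> *; exact: sqr_ge0.
  by apply: subset_trans yF; exact: cube_eball.
(* The sup bound is applied in dimension [d], in the coordinates of the face, and the volume of [T]
   is merely bounded by that of a cube of size [r] in dimension [d.+1]; the quotient of the two
   volumes is the factor [r]. *)
have fle x : T x -> q ((x - forig F) *m (fframe F)^T) ^+ 2 <= C * J / l ^+ d.
  move=> Tx; rewrite ler_pdivlMr//.
  apply: le_trans (HC _ y0 _ l pq l0 _) _ => [i|]; last by rewrite ler_pM2l.
  by rewrite -mulrA -rl; exact: Ty.
have J0 : 0 <= J by apply: vint_ge0 => x _; exact: sqr_ge0.
have R0 : 0 < (rho + 1) * r by rewrite mulr_gt0// ltr_wpDl.
apply: le_trans (_ : _ <= C * J / l ^+ d * (2 * ((rho + 1) * r)) ^+ d.+1) _.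
  apply: le_trans (_ : _ <= vint T (fun=> C * J / l ^+ d)) _.
    by apply: le_vint => //; [exact: ispolyX|exact: ispoly_cst].
  rewrite vint_cst// -(vint_cube1 c R0) ler_wpM2l//.
    by apply: divr_ge0; [exact: mulr_ge0 (ltW C0) J0|exact: ltW].
  by apply: vint_subset; [exact: tame_cube|by case: tT|exact: ispoly_cst|by move=> *; exact: ler01|].
rewrite (_ : (2 * ((rho + 1) * r)) ^+ d.+1 = (2 * (rho + 1)) ^+ d.+1 * (r * r ^+ d)); last first.
  by rewrite mulrA exprMn -exprS.
set P := _ ^+ d.+1.
set Q := d.+1%:R ^+ d; have -> : r ^+ d = Q * l ^+ d by rewrite {1}rl [LHS]exprMn.
set L := l ^+ d.
by rewrite (_ : C * J / L * (P * (r * (Q * L))) = C * P * Q * r * J)//; field; exact: lt0r_neq0.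
Qed.

End PolynomialNorms.

(** * Geometry of elements, pyramids and faces *)

Section MeshGeometry.
Variables (R : realType) (d : nat) (rhoK rhoT : R).
Variables (M : mesh R d.+1) (Omega : set 'rV[R]_d.+1).
Hypotheses (d0 : (0 < d)%N) (isM : is_mesh M Omega) (sr : shape_regular M rhoK rhoT).
Implicit Types (K : elt M) (F : face M).

Let wf F : facet_wf (facet_of F) := mesh_facet isM F.
Local Notation n_ F := (fnrm (facet_of F)).
Local Notation o_ F := (forig (facet_of F)).
Local Notation fr_ F := (fframe (facet_of F)).
(** The absolute values give a nonnegative ratio without any sign assumption on the two
    parameters. *)
Definition mesh_rho : R := `|rhoK| * `|rhoT|.

Lemma mesh_rho_ge0 : 0 <= mesh_rho. Proof. by rewrite mulr_ge0. Qed.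

Lemma pyr_cell K F : incident K F -> pyr K F `<=` cell K.
Proof. by move=> KF x px; rewrite (mesh_pyr isM K); exists F. Qed.

Lemma fset_pyr K F : Defs.fset F `<=` pyr K F.
Proof.
by move=> x Fx; exists x, 1; split; rewrite ?ler01 ?lexx// subrr scale0r add0r scale1r.
Qed.

Lemma cell_tame K : tame (cell K).
Proof. exact: polytope_tame (mesh_cell isM K). Qed.

Lemma fbase_tame F : tame (fbase (facet_of F)).
Proof. by apply: polytope_tame; have [] := wf F. Qed.

Lemma fset_neq0 F : Defs.fset F !=set0.
Proof. by have [[_ _ [y Hy]] _ _ _] := wf F; exists (Defs.fmap (facet_of F) y), y. Qed.

Lemma cell_bounded K : exists B : R, forall x, cell K x -> forall i, `|x 0 i| <= B.
Proof. by have [] := cell_tame K. Qed.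

Lemma pyr_bounded K F : incident K F ->
  exists B : R, forall x, pyr K F x -> forall i, `|x 0 i| <= B.
Proof. by move=> KF; have [B HB] := cell_bounded K; exists B => x /(pyr_cell KF); exact: HB. Qed.

(** A pyramid is the continuous image of base times unit interval; compactness then makes it closed,
    hence measurable. *)
Lemma pyr_compact K F : compact (pyr K F).
Proof.
have [pF _ _ _] := wf F.
pose g (z : 'rV[R]_d * R) : 'rV[R]_d.+1 :=
  (1 - z.2) *: Defs.center K + z.2 *: Defs.fmap (facet_of F) z.1.
have -> : pyr K F = g @` (fbase (facet_of F) `*` `[0, 1]).
  apply/seteqP; split => x.
    by move=> [_ [t [[y Fy <-] t01 ->]]]; exists (y, t) => //; split => //=; rewrite in_itv.
  move=> [[y t] [/= Fy]]; rewrite in_itv => t01 <-.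
  by exists (Defs.fmap (facet_of F) y), t; split => //; exists y.
apply: continuous_compact; last first.
  apply: compact_setX; [exact: polytope_compact|exact: segment_compact].
apply: continuous_subspaceT => z.
have c1 : {for z, continuous (fun z : 'rV[R]_d * R => z.1)} by exact: cvg_fst.
have c2 : {for z, continuous (fun z : 'rV[R]_d * R => z.2)} by exact: cvg_snd.
apply: cvgD.
  by apply: cvgZr_tmp; apply: cvgB => //; exact: cvg_cst.
apply: cvgZ => //; apply: cvgD; first exact: cvg_cst.
rewrite [X in X @ _ --> _](_ : _ = fun z : 'rV[R]_d * R => \sum_i z.1 0 i *: row i (fr_ F)); last first.
  by apply/funext => w; rewrite mulmx_sum_row.
rewrite mulmx_sum_row; apply: (cvg_big add_continuous) => i _; apply: cvgZr_tmp.
exact: (cvg_comp _ _ c1 (@coord_continuous _ _ _ 0 i z.1)).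
Qed.

Lemma pyr_tame K F : incident K F -> tame (pyr K F).
Proof. by move=> KF; apply: compact_tame; [exact: pyr_compact|exact: pyr_bounded]. Qed.

Lemma pyr_height K F x : pyr K F x -> exists t y,
  [/\ fbase (facet_of F) y, 0 <= t <= 1, x = (1 - t) *: Defs.center K + t *: Defs.fmap (facet_of F) y &
    ip (x - o_ F) (n_ F) = (1 - t) * ip (Defs.center K - o_ F) (n_ F)].
Proof.
move=> [_ [t [[y Fy <-] t01 ->]]]; exists t, y; split => //.
rewrite -ipZl -[LHS]addr0 -(mulr0 (- t)) -(fmap_hyperplane (wf F) y) -ipZl -ipDl.
congr (ip _ _); apply/rowP => i; rewrite !mxE; ring.
Qed.

(** The only place where shape regularity is turned into geometry: a single radius [r] serves the
    pyramid, its base and the element. The last conclusion, that the apex is off the hyperplane of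
    [F], makes the sign in [outn] equal to 1 or -1. *)
Lemma mesh_geometry K F : incident K F -> exists r c0 y0,
  [/\ 0 < r, eball c0 r `<=` pyr K F, eball y0 r `<=` fbase (facet_of F),
      diam (cell K) <= mesh_rho * r & ip (o_ F - Defs.center K) (n_ F) != 0].
Proof.
move=> KF; have [chK inT] := sr; have [c0 [r [r0 cT dT]]] := inT _ _ KF.
have nn : ip (n_ F) (n_ F) = 1 := nrm_ip1 (wf F).
set H := ip (Defs.center K - o_ F) (n_ F).
have c0T : pyr K F c0 by apply: cT; rewrite /eball/= subrr /enorm ip0l sqrtr0.
have H0 : H != 0.
  (* An apex in the hyperplane of [F] would flatten the whole pyramid, which contains a ball. *)
  apply/negP => /eqP H0.
  have hz x : pyr K F x -> ip (x - o_ F) (n_ F) = 0.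
    by move=> /pyr_height[t [y [_ _ _ ->]]]; rewrite -/H H0 mulr0.
  have c1T : pyr K F (c0 + (r / 2) *: n_ F).
    apply: cT; rewrite /eball/= addrC addKr /enorm ipZl ipZr nn mulr1 -expr2 sqrtr_sqr.
    by rewrite gtr0_norm ?divr_gt0//; lra.
  have := hz _ c1T; rewrite -addrA addrCA ipDl ipZl nn hz// mulr1 addr0.
  by move: r0; lra.
have [t0 [y0 [Fy0 /andP[t00 t01] c0E h0]]] := pyr_height c0T.
(* Points of the ball on the slice through [c0] parallel to [F] all have the height of [c0], hence
   the same parameter [t0]: the slice is a copy of [F] shrunk by [t0]. *)
have lift_ball (z : 'rV[R]_d) : enorm z < r ->
    exists2 y, fbase (facet_of F) y & z = t0 *: (y - y0).
  move=> zr.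
  have : pyr K F (c0 + z *m fr_ F).
    by apply: cT; rewrite /eball/= addrC addKr /enorm frame_isom.
  move=> /pyr_height[t [y [Fy _ zE hz]]]; exists y => //.
  have tt0 : t = t0.
    move: hz; rewrite addrAC (ipDl (c0 - o_ F)) (frame_nrm (wf F) z) addr0 h0 => /(mulIf H0).
    by move=> /addrI/oppr_inj.
  move: zE; rewrite tt0 {1}c0E -addrA => /addrI; rewrite /Defs.fmap => zE.
  have : z *m fr_ F = (t0 *: (y - y0)) *m fr_ F.
    move: zE; rewrite !scalerDr -!addrA => /addrI zE.
    by rewrite -scalerDr -scalemxAl mulmxDl mulNmx scalerDr scalerN -zE addrAC subrr add0r.
  by move=> /(congr1 (fun w => w *m (fr_ F)^T)); rewrite !frameK.
pose e0 : 'rV[R]_d := delta_mx 0 (Ordinal d0).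
have e01 : ip e0 e0 = 1.
  rewrite ip_rV (bigD1 (Ordinal d0))//= big1 => [|j /negbTE jd]; rewrite !mxE ?eqxx ?mul1r ?addr0//.
  by rewrite jd mul0r.
have enorm_e0 a : 0 <= a -> enorm (a *: e0) = a.
  by move=> a0; rewrite /enorm ipZl ipZr e01 mulr1 -expr2 sqrtr_sqr ger0_norm.
have t0_gt0 : 0 < t0.
  rewrite lt0r t00 andbT; apply/negP => /eqP tz.
  have := enorm_e0 (r / 2); rewrite divr_ge0 ?ltW// => /(_ isT) er.
  have [|y _] := lift_ball ((r / 2) *: e0); first by rewrite er; lra.
  rewrite tz scale0r => /(congr1 (@enorm R _ _)); rewrite er /enorm ip0l sqrtr0.
  by move: r0; lra.
(* As [t0 <= 1], undoing the shrinking gives a ball in the base that is at least as large as the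
   slice of the original one. *)
have yF : eball y0 r `<=` fbase (facet_of F).
  move=> y; rewrite /eball/= => yr.
  have [|y' Fy' E] := lift_ball (t0 *: (y - y0)).
    rewrite /enorm ipZl ipZr mulrA -expr2 sqrtrM ?sqr_ge0// sqrtr_sqr (ger0_norm t00).
    by apply: le_lt_trans yr; rewrite ler_piMl// sqrtr_ge0.
  have := scalerI (lt0r_neq0 t0_gt0) E => /subIr ->//.
exists r, c0, y0; split => //; last first.
  by rewrite -opprB ipNl oppr_eq0.
(* Chain of bounds: [diam K] is at most [rhoK] times the radius of some ball in [K], so of the
   largest one. A point [z] of [F] lies on the boundary of [K], hence outside that open ball, and
   its distance to the centre is at most the diameter of the pyramid, which is at most
   [rhoT * r]. *)
have [c' [r' [r'0 c'K dK]]] := chK K.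
have [rK [rK0 KK] Kmax] := mesh_center isM K.
have r'K : r' <= rK by apply: (Kmax c'); move=> x /c'K [].
have [z Fz] := fset_neq0 F.
have zK : rK <= enorm (z - Defs.center K).
  rewrite leNgt; apply/negP => zlt.
  have : bdry (cell K) z by rewrite (mesh_bdry isM K); exists F.
  by move=> [_]; apply; exact: eball_interior KK _ zlt.
have zT : enorm (z - Defs.center K) <= diam (pyr K F).
  apply: diam_ge; [exact: pyr_bounded|exact: fset_pyr|].
  by exists z, 0; split; rewrite ?lexx ?ler01// subr0 scale1r scale0r addr0.
rewrite /mesh_rho -mulrA.
apply: le_trans dK _; apply: le_trans (ler_wpM2r (ltW r'0) (ler_norm rhoK)) _.
rewrite ler_wpM2l//; apply: le_trans r'K _; apply: le_trans zK _.
apply: le_trans zT _; apply: le_trans dT _.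
by apply: ler_wpM2r; [exact: ltW|exact: ler_norm].
Qed.

End MeshGeometry.

(** * Bounds uniform over shape-regular meshes *)

Lemma polyfun_affine (R : realType) n n' (A : 'M[R]_(n, n')) (b : 'rV[R]_n') i :
  polyfun 1 (fun x : 'rV[R]_n => (x *m A + b) 0 i).
Proof.
apply: (@polyfun_ext _ _ _ (fun x => \sum_j A j i * x 0 j + b 0 i)).
  by move=> x; rewrite !mxE; congr (_ + _); apply: eq_bigr => j _; rewrite mulrC.
apply: polyfunD; last exact: polyfun_cst.
by apply: polyfun_sum => j _; apply: polyfunZ; exact: polyfun_coord.
Qed.

Lemma polyfun_fmap (R : realType) d (F : facet R d) m f :
  polyfun m f -> polyfun m (f \o Defs.fmap F).
Proof.
apply: polyfun_comp_affine => i; rewrite /Defs.fmap.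
by under eq_fun do rewrite addrC; exact: polyfun_affine.
Qed.

Lemma polyfun_fext (R : realType) d (F : facet R d) m (f : 'rV[R]_d -> R) :
  polyfun m f -> polyfun m (fext F f).
Proof.
apply: (@polyfun_comp_affine _ _ _ m f (fun x => x - ip (x - forig F) (fnrm F) *: fnrm F)) => i.
apply: (@polyfun_ext _ _ _ (fun x => x 0 i -
   (\sum_j fnrm F 0 j * x 0 j - ip (forig F) (fnrm F)) * fnrm F 0 i)).
  move=> x; rewrite !mxE ipBl; congr (_ - (_ - _) * _).
  rewrite [RHS]ip_rV; by apply: eq_bigr => j _; rewrite mulrC.
apply: polyfunB; first exact: polyfun_coord.
under eq_fun do rewrite mulrC.
apply: polyfunZ; apply: polyfunB; last exact: polyfun_cst.
by apply: polyfun_sum => j _; apply: polyfunZ; exact: polyfun_coord.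
Qed.

Section UniformBounds.
Variables (R : realType) (d : nat) (rhoK rhoT : R).
Hypothesis d0 : (0 < d)%N.
Local Notation rho := (mesh_rho rhoK rhoT).

(** The cube to which [poly_norm_equiv] compares the element can be taken inside the pyramid. *)
Lemma cell_pyr_bound m : exists2 C : R, 0 < C &
  forall Omega (M : mesh R d.+1), is_mesh M Omega -> shape_regular M rhoK rhoT ->
  forall (K : elt M) (F : face M) f, incident K F -> polyfun m f ->
    vint (cell K) (fun x => f x ^+ 2) <= C * vint (pyr K F) (fun x => f x ^+ 2).
Proof.
have [C C0 HC] := @poly_norm_equiv R d.+1 m _ (mesh_rho_ge0 rhoK rhoT).
exists C => // Omega M isM sr K F f KF pf.
have [r [c0 [y0 [r0 cT yF dK H0]]]] := mesh_geometry d0 isM sr KF.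
have cK : eball c0 r `<=` cell K by apply: subset_trans (pyr_cell isM KF).
apply: le_trans (HC _ _ c0 r (cell_tame isM K) pf r0 cK dK) _.
rewrite ler_pM2l//; apply: vint_subset.
- exact: (pyr_tame isM KF).
- exact: measurable_cube.
- by apply: ispolyX; exists m.
- by move=> x _; exact: sqr_ge0.
- by apply: subset_trans cT; exact: cube_eball.
Qed.

(* The pyramids of an element contain disjoint cubes of comparable size, hence
   there is no need to know that their common boundaries are negligible. *)
Lemma pyr_sum_bound m : exists2 C : R, 0 < C &
  forall Omega (M : mesh R d.+1), is_mesh M Omega -> shape_regular M rhoK rhoT ->
  forall (K : elt M) f, polyfun m f ->
    \sum_(F | incident K F) vint (pyr K F) (fun x => f x ^+ 2) <=
      C * vint (cell K) (fun x => f x ^+ 2).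
Proof.
have [C C0 HC] := @poly_norm_equiv R d.+1 m _ (mesh_rho_ge0 rhoK rhoT).
exists C => // Omega M isM sr K f pf.
have pf2 : ispoly (fun x => f x ^+ 2) by apply: ispolyX; exists m.
have : forall F : face M, exists rc : R * 'rV[R]_d.+1, incident K F ->
    [/\ 0 < rc.1, eball rc.2 rc.1 `<=` pyr K F & diam (cell K) <= rho * rc.1].
  move=> F; have [KF|_] := boolP (incident K F); last by exists (0, 0).
  by have [r [c0 [y0 [r0 cT _ dK _]]]] := mesh_geometry d0 isM sr KF; exists (r, c0).
move=> /choice[rc Hrc].
pose Q F := cube (rc F).2 ((rc F).1 / d.+2%:R).
have QT F : incident K F -> Q F `<=` pyr K F.
  by move=> /Hrc[r0 cT _]; apply: subset_trans cT; exact: cube_eball.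
apply: le_trans (_ : _ <= \sum_(F | incident K F) C * vint (Q F) (fun x => f x ^+ 2)) _.
  apply: ler_sum => F KF; have [r0 cT dK] := Hrc _ KF.
  have cK : eball (rc F).2 (rc F).1 `<=` cell K by apply: subset_trans (pyr_cell isM KF).
  apply: le_trans (HC _ _ _ _ (cell_tame isM K) pf r0 cK dK).
  apply: vint_subset => //; first exact: cell_tame isM K.
  - by have [] := pyr_tame isM KF.
  - by move=> x _; exact: sqr_ge0.
  - exact: (pyr_cell isM KF).
rewrite -mulr_sumr ler_pM2l//; apply: sum_vint_le => //.
- exact: cell_tame isM K.
- by move=> x _; exact: sqr_ge0.
- move=> F KF; split; first exact: measurable_cube.
  by apply: subset_trans (pyr_cell isM KF); exact: QT.
move=> F F' KF KF' FF'.
have QI G : incident K G -> Q G `<=` (pyr K G)°.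
  move=> KG; have [r0 _ _] := Hrc _ KG.
  have oQ : open (Q G) by apply: open_cube; rewrite divr_gt0.
  by rewrite -open_subsetE//; exact: QT.
apply/seteqP; split => // x [Qx Qx'].
have := mesh_pyr_disj isM KF KF' FF' => /seteqP[H _].
by apply: (H x); split; exact: QI.
Qed.

(** The centre of the ball and a point at distance [r / 2] from it both lie in the face. This trades
    the radius [r] for [h_F]. *)
Lemma face_diam (F : facet R d.+1) (y0 : 'rV[R]_d) r : facet_wf F -> 0 < r ->
  (exists B : R, forall x, fset_of F x -> forall i, `|x 0 i| <= B) ->
  eball y0 r `<=` fbase F -> r <= 2 * diam (fset_of F).
Proof.
move=> wfF r0 bF yF.
pose e0 : 'rV[R]_d := delta_mx 0 (Ordinal d0).
have e01 : ip e0 e0 = 1.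
  rewrite ip_rV (bigD1 (Ordinal d0))//= big1 => [|j /negbTE jd]; rewrite !mxE ?eqxx ?mul1r ?addr0//.
  by rewrite jd mul0r.
have er : enorm ((r / 2) *: e0) = r / 2.
  by rewrite /enorm ipZl ipZr e01 mulr1 -expr2 sqrtr_sqr ger0_norm// divr_ge0// ltW.
have F1 : fset_of F (Defs.fmap F (y0 + (r / 2) *: e0)).
  by eexists; [|reflexivity]; apply: yF; rewrite /eball/= addrC addKr er; lra.
have F2 : fset_of F (Defs.fmap F y0).
  by eexists; [|reflexivity]; apply: yF; rewrite /eball/= subrr /enorm ip0l sqrtr0.
have := diam_ge bF F1 F2.
have -> : Defs.fmap F (y0 + (r / 2) *: e0) - Defs.fmap F y0 = ((r / 2) *: e0) *m fframe F.
  by rewrite /Defs.fmap mulmxDl opprD addrACA subrr add0r addrAC subrr add0r.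
by rewrite {1}/enorm frame_isom// -/(enorm _) er; lra.
Qed.

Lemma mesh_face_diam_gt0 Omega (M : mesh R d.+1) (F : face M) :
  is_mesh M Omega -> shape_regular M rhoK rhoT -> 0 < diam (Defs.fset F).
Proof.
move=> isM sr; have KF : incident (side1 F) F by rewrite /incident eqxx.
have [r [c0 [y0 [r0 cT yF dK H0]]]] := mesh_geometry d0 isM sr KF.
have bF : exists B : R, forall x, Defs.fset F x -> forall i, `|x 0 i| <= B.
  have [B HB] := pyr_bounded isM KF; exists B => x Fx; apply: HB.
  exact: fset_pyr.
by have := face_diam (mesh_facet isM F) r0 bF yF; move: r0; rewrite -/(Defs.fset F); lra.
Qed.

Lemma face_extension_bound m : exists2 C : R, 0 < C &
  forall Omega (M : mesh R d.+1), is_mesh M Omega -> shape_regular M rhoK rhoT ->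
  forall (K : elt M) (F : face M) p, incident K F -> polyfun m p ->
    vint (pyr K F) (fun x => fext (facet_of F) p x ^+ 2) <=
      C * diam (Defs.fset F) * fint (facet_of F) (fun x => p x ^+ 2).
Proof.
have rho0 := mesh_rho_ge0 rhoK rhoT.
have [C C0 HC] := @extension_bound R d m _ rho0.
exists (2 * C) => [|Omega M isM sr K F p KF pp]; first by rewrite mulr_gt0.
have wfF := mesh_facet isM F.
have [r [c0 [y0 [r0 cT yF dK H0]]]] := mesh_geometry d0 isM sr KF.
have bF : exists B : R, forall x, Defs.fset F x -> forall i, `|x 0 i| <= B.
  have [B HB] := pyr_bounded isM KF; exists B => x Fx; apply: HB.
  exact: fset_pyr.
have rF := face_diam wfF r0 bF yF.
have KB x x' : pyr K F x -> pyr K F x' -> enorm (x - x') <= rho * r.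
  move=> Tx Tx'; apply: le_trans dK; apply: diam_ge; first exact: cell_bounded isM K.
    exact: (pyr_cell isM KF).
  exact: (pyr_cell isM KF).
have Tc : pyr K F `<=` cube c0 ((rho + 1) * r).
  move=> x Tx i; have Tc0 : pyr K F c0.
    by apply: cT; rewrite /eball/= subrr /enorm ip0l sqrtr0.
  have := entry_le_enorm (x - c0) 0 i; rewrite !mxE => /le_lt_trans; apply.
  by apply: le_lt_trans (KB _ _ Tx Tc0) _; rewrite ltr_pM2r// ltrDl.
have Ty x : pyr K F x -> forall i,
    `|((x - forig (facet_of F)) *m (fframe (facet_of F))^T) 0 i - y0 0 i| <= rho * r.
  move=> Tx i.
  have T0 : pyr K F (Defs.fmap (facet_of F) y0).
    apply: fset_pyr; exists y0 => //.
    by apply: yF; rewrite /eball/= subrr /enorm ip0l sqrtr0.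
  have E : (x - Defs.fmap (facet_of F) y0) *m (fframe (facet_of F))^T =
      (x - forig (facet_of F)) *m (fframe (facet_of F))^T - y0.
    by rewrite /Defs.fmap opprD addrA mulmxDl mulNmx (frameK wfF).
  have -> : ((x - forig (facet_of F)) *m (fframe (facet_of F))^T) 0 i - y0 0 i =
      ((x - Defs.fmap (facet_of F) y0) *m (fframe (facet_of F))^T) 0 i.
    by rewrite E [RHS]mxE; congr (_ + _); rewrite [RHS]mxE.
  apply: le_trans (entry_le_enorm _ _ _) _.
  by apply: le_trans (KB _ _ Tx T0); exact: frame_enorm.
have pq : polyfun m (p \o Defs.fmap (facet_of F)) by exact: polyfun_fmap.
have pqe : ispoly (fun x => (p \o Defs.fmap (facet_of F))
    ((x - forig (facet_of F)) *m (fframe (facet_of F))^T)).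
  exists m; apply: polyfun_ext (polyfun_fext (facet_of F) pp) => x.
  exact: fextE wfF _ _ _.
have := HC (facet_of F) (pyr K F) _ c0 y0 r (pyr_tame isM KF) (fbase_tame isM F) pq pqe r0 yF Tc Ty.
under [X in X <= _]eq_vint => x _ do rewrite -[(p \o _) _](fextE wfF p x).
move=> /le_trans; apply; apply: ler_wpM2r.
  by apply: vint_ge0 => x _; exact: sqr_ge0.
by rewrite [2 * C]mulrC -mulrA ler_pM2l.
Qed.

End UniformBounds.

(** * The strain as a polynomial *)

Section StrainPoly.
Variables (R : realType) (d : nat).

Lemma polyfun0_cst (f : 'rV[R]_d -> R) : polyfun 0 f -> forall x, f x = f 0.
Proof.
move: f; apply: polyfun_ind => //.
- by move=> f g Hf Hg x; rewrite Hf Hg.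
- by move=> a f Hf x; rewrite Hf.
by move=> [|//] _ x; rewrite /monomial !big_nil.
Qed.

Lemma is_diff_sum (V W : normedModType R) (I : Type) (r : seq I)
    (f df : I -> V -> W) (x : V) : (forall i, is_diff x (f i) (df i)) ->
  is_diff x (fun y => \sum_(i <- r) f i y) (fun h => \sum_(i <- r) df i h).
Proof.
move=> H; elim: r => [|i r IH].
  rewrite (_ : (fun _ => _) = cst 0); last by apply/funext => y; rewrite big_nil.
  by apply: is_diff_eq; apply/funext => y; rewrite big_nil.
rewrite (_ : (fun y => _) = f i + (fun y => \sum_(i <- r) f i y)); last first.
  by apply/funext => y; rewrite big_cons.
have ? := H i; apply: is_diff_eq.
by apply/funext => y; rewrite big_cons.
Qed.

Lemma eps_polyfun k (v : 'rV[R]_d -> 'rV[R]_d) : polyvec k.+1 v ->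
  forall i j, polyfun k (fun x => eps v x i j).
Proof.
move=> pv.
have /choice[g Hg] : forall j, exists g : 'I_d -> 'rV[R]_d -> R, (forall i, polyfun k (g i)) /\
    forall x : 'rV[R]_d, is_diff x (fun x => v x 0 j) (fun h => \sum_i h 0 i * g i x).
  by move=> j; have [g g1 g2] := polyfun_gradient (pv j); exists g.
have jacE x i j : jacobian v x i j = g j i x.
  (* The differential of [v] is assembled from those of its coordinates, by writing [v] in the
     standard basis. *)
  have D : is_diff x v (fun h => \sum_j (\sum_i h 0 i * g j i x) *: (delta_mx 0 j : 'rV[R]_d)).
    rewrite (_ : v = fun y => \sum_j v y 0 j *: (delta_mx 0 j : 'rV[R]_d)); last first.
      by apply/funext => y; rewrite [LHS]row_sum_delta.
    apply: is_diff_sum => l; have [_ /(_ x) ?] := Hg l.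
    exact: (@is_diff_comp _ _ _ _ (fun y => v y 0 l) _ ( *:%R^~ (delta_mx 0 l : 'rV[R]_d))).
  rewrite /jacobian mxE [in LHS]diff_val summxE (bigD1 j)//= mxE [X in _ * X]mxE !eqxx mulr1.
  rewrite [X in _ + X]big1 ?addr0 => [|l /negbTE jl]; last by rewrite !mxE eq_sym jl mulr0.
  rewrite (bigD1 i)//= mxE !eqxx mul1r big1 ?addr0// => l /negbTE jl.
  by rewrite mxE jl mul0r.
move=> i j; apply: (@polyfun_ext _ _ _ (fun x => 2^-1 * (g j i x + g i j x))).
  by move=> x; rewrite /eps /symm !mxE -!jacE !mxE.
by apply: polyfunZ; apply: polyfunD; [have [] := Hg j|have [] := Hg i].
Qed.

Lemma eps_sym (v : 'rV[R]_d -> 'rV[R]_d) x : (eps v x)^T = eps v x.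
Proof. by rewrite /eps /symm linearZ linearD /= trmxK addrC. Qed.

End StrainPoly.

(** * Symmetric, tangential and normal tensors *)

Section Tensors.
Variables (R : realType) (d : nat).
Implicit Types (s t x y : 'rV[R]_d) (A B : 'M[R]_d).

Lemma mulvDl A B x : mulv (A + B) x = mulv A x + mulv B x.
Proof. by rewrite /mulv mulmxDl linearD. Qed.

Lemma mulvZl a A x : mulv (a *: A) x = a *: mulv A x.
Proof. by rewrite /mulv -scalemxAl linearZ. Qed.

Lemma mulvZr a A x : mulv A (a *: x) = a *: mulv A x.
Proof. by rewrite /mulv linearZ /= -scalemxAr linearZ. Qed.

Lemma mulvDr A x y : mulv A (x + y) = mulv A x + mulv A y.
Proof. by rewrite /mulv linearD /= mulmxDr linearD. Qed.

Lemma mulvNl A x : mulv (- A) x = - mulv A x.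
Proof. by rewrite -scaleN1r mulvZl scaleN1r. Qed.

Lemma mulvNr A x : mulv A (- x) = - mulv A x.
Proof. by rewrite -scaleN1r mulvZr scaleN1r. Qed.

Lemma mulvE A x : mulv A x = x *m A^T.
Proof. by rewrite /mulv trmx_mul trmxK. Qed.

Lemma ip_mulv A x y : ip (mulv A x) y = ip x (y *m A).
Proof. by rewrite mulvE /ip trmx_mul mulmxA. Qed.

Lemma tensE s t i j : tens s t i j = s 0 i * t 0 j.
Proof. by rewrite /tens mxE big_ord1 mxE. Qed.

Lemma tens_tr s t : (tens s t)^T = tens t s.
Proof. by rewrite /tens trmx_mul trmxK. Qed.

Lemma mulv_tens s t x : mulv (tens s t) x = ip t x *: s.
Proof.
apply/rowP => i; rewrite mulvE tens_tr !mxE ip_rV mulr_suml; apply: eq_bigr => j _.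
by rewrite tensE mulrCA mulrA mulrC mulrA mulrC.
Qed.

Lemma symm_tr A : (symm A)^T = symm A.
Proof. by rewrite /symm linearZ linearD /= trmxK addrC. Qed.

Lemma symmE s t i j : symm (tens s t) i j = 2^-1 * (s 0 i * t 0 j + s 0 j * t 0 i).
Proof. rewrite /symm mxE; congr (_ * _); rewrite mxE tensE; congr (_ + _).
by rewrite mxE tensE. Qed.

Lemma symmZ a A : symm (a *: A) = a *: symm A.
Proof. by rewrite /symm linearZ /= -scalerDr scalerA mulrC -scalerA. Qed.

Lemma tensZ a s t : tens (a *: s) t = a *: tens s t.
Proof. by rewrite /tens linearZ /= -scalemxAl. Qed.

Lemma mulv_symm_tens s t x :
  mulv (symm (tens s t)) x = 2^-1 *: (ip t x *: s + ip s x *: t).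
Proof. by rewrite /symm mulvZl mulvDl tens_tr !mulv_tens. Qed.

Lemma ip_tr m n (A B : 'M[R]_(m, n)) : ip A^T B^T = ip A B.
Proof. by rewrite /ip trmxK mxtrace_mulC -mxtrace_tr trmx_mul trmxK. Qed.

Lemma ip_symm A : ip (symm A) (symm A) <= ip A A.
Proof.
rewrite /symm ipZl ipZr; have := ip_sqrD A A^T; rewrite ip_tr; lra.
Qed.

Lemma ip_tens s t : ip (tens s t) (tens s t) = ip s s * ip t t.
Proof.
rewrite !ip_rV ipE mulr_suml; apply: eq_bigr => i _; rewrite mulr_sumr.
by apply: eq_bigr => j _; rewrite !tensE; ring.
Qed.

(** With [T] the sum, [ip T T] is the sum of the [a i * ip (b i) T]; Cauchy-Schwarz gives the claim
    times [ip T T]. *)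
Lemma ip_sum_le (I : finType) (a : I -> R) (b : I -> 'M[R]_d) :
  (forall i, ip (b i) (b i) <= 1) ->
  ip (\sum_i a i *: b i) (\sum_i a i *: b i) <= #|I|%:R * \sum_i a i ^+ 2.
Proof.
move=> b1; set T := \sum_i _ *: _; set A := \sum_i _ ^+ 2.
have A0 : 0 <= A by apply: sumr_ge0 => i _; exact: sqr_ge0.
have T0 := ip_ge0 T.
have TE : ip T T = \sum_i a i * ip (b i) T.
  by rewrite {1}/T ip_suml; apply: eq_bigr => i _; rewrite ipZl.
have := sqr_sum_le a (fun i => ip (b i) T); rewrite -TE -/A => h.
have h2 : \sum_i ip (b i) T ^+ 2 <= #|I|%:R * ip T T.
  rewrite mulr_natl -sumr_const; apply: ler_sum => i _.
  apply: le_trans (ip_CS _ _) _; rewrite -[leRHS]mul1r.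
  by apply: ler_wpM2r.
have [T00|Tp] := eqVneq (ip T T) 0; first by rewrite T00 mulr_ge0.
have Tpos : 0 < ip T T by rewrite lt0r Tp.
rewrite -(ler_pM2r Tpos) -expr2; apply: le_trans h _.
by rewrite [_ * A]mulrC -mulrA; apply: ler_wpM2l.
Qed.

End Tensors.

Section TangentialTensors.
Variables (R : realType) (d : nat) (F : facet R d).

Lemma tangS0 : tangS F 0.
Proof.
exists 0%N, (fun=> 0), (fun=> 0), (fun=> 0); split; first by move=> [].
by rewrite big_ord0.
Qed.

Lemma tangSZ a A : tangS F A -> tangS F (a *: A).
Proof.
move=> [m [c [s [t [H ->]]]]]; exists m, (fun i => a * c i), s, t; split => //.
by rewrite scaler_sumr; apply: eq_bigr => i _; rewrite scalerA.
Qed.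

Lemma tangSD A B : tangS F A -> tangS F B -> tangS F (A + B).
Proof.
move=> [m [c [s [t [H ->]]]]] [m' [c' [s' [t' [H' ->]]]]].
pose u T (f : 'I_m -> T) (f' : 'I_m' -> T) (i : 'I_(m + m')) :=
  match fintype.split i with inl j => f j | inr j => f' j end.
exists (m + m')%N, (u _ c c'), (u _ s s'), (u _ t t'); split.
  by move=> i; rewrite /u; case: (fintype.split i).
rewrite big_split_ord /=; congr (_ + _); apply: eq_bigr => i _.
  by rewrite /u -[lshift _ _]/(unsplit (inl i)) unsplitK.
by rewrite /u -[rshift _ _]/(unsplit (inr i)) unsplitK.
Qed.

Lemma tangS_sum (I : Type) (r : seq I) (P : pred I) (b : I -> 'M[R]_d) :
  (forall i, P i -> tangS F (b i)) -> tangS F (\sum_(i <- r | P i) b i).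
Proof.
move=> Hb; elim/big_ind: _ => //; [exact: tangS0|exact: tangSD].
Qed.

(** Hence tangential tensors on a pyramid change neither the face terms nor the continuity across
    [F]. *)
Lemma tangS_mulv A : tangS F A -> mulv A (fnrm F) = 0.
Proof.
move=> [m [c [s [t [H ->]]]]]; elim/big_ind: _ => [|B C HB HC|i _].
- by rewrite mulvE trmx0 mulmx0.
- by rewrite mulvDl HB HC addr0.
have [Hs Ht] := H i; rewrite mulvZl mulv_symm_tens Hs Ht !scale0r addr0.
by rewrite !scaler0.
Qed.

Lemma tangS_tr A : tangS F A -> A^T = A.
Proof.
move=> [m [c [s [t [H ->]]]]]; rewrite linear_sum; apply: eq_bigr => i _.
by rewrite linearZ /= symm_tr.
Qed.

End TangentialTensors.

Section NormalTensors.
Variables (R : realType) (d k : nat) (F : facet R d.+1).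
Hypothesis wfF : facet_wf F.
Local Notation vec := 'rV[R]_d.+1.
Local Notation nu := (fnrm F).

(** As [symm (tens w n)] maps the unit normal [n] to [(w + (w . n) n) / 2], this [w] is the one that
    yields the normal component [fext F p]. *)
Definition sigma1 (p : vec -> vec) (x : vec) : 'M[R]_d.+1 :=
  symm (tens (2 *: fext F p x - ip (fext F p x) nu *: nu) nu).

Lemma sigma1_normal p x : mulv (sigma1 p x) nu = fext F p x.
Proof.
rewrite /sigma1 mulv_symm_tens (nrm_ip1 wfF) scale1r ipBl !ipZl (nrm_ip1 wfF) mulr1.
set q := fext F p x; set a := ip q nu.
rewrite (_ : 2 * a - a = a); last by ring.
by rewrite subrK scalerA mulVf ?pnatr_eq0// scale1r.
Qed.

(** The constant is [2 * 2^2 + 2 * 1], from the two terms of [w]. *)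
Lemma sigma1_ip p x :
  ip (sigma1 p x) (sigma1 p x) <= 10 * ip (fext F p x) (fext F p x).
Proof.
apply: le_trans (ip_symm _) _; rewrite ip_tens (nrm_ip1 wfF) mulr1.
set q := fext F p x; apply: le_trans (ip_sqrD _ _) _.
rewrite ipNl ipNr opprK !ipZl !ipZr (nrm_ip1 wfF) mulr1.
have := ip_CS q nu; rewrite (nrm_ip1 wfF) mulr1; lra.
Qed.

(** Rigid motions have degree 1, so [k.+1] is the bound that covers [k = 0] along with [k >= 1]. *)
Lemma Vk_polyvec (p : vec -> vec) : Vk k p -> polyvec k.+1 p.
Proof.
rewrite /Vk; case: eqP => [->|_].
  move=> [a [B [_ pE]]] i; have -> : p = fun x => x *m B^T + a.
    by apply/funext => x; rewrite pE mulvE addrC.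
  exact: polyfun_affine.
by move=> pp i; apply: polyfun_le (pp i).
Qed.

Lemma Vk0 : Vk k (fun _ : vec => 0).
Proof.
rewrite /Vk; case: eqP => _.
  by exists 0, 0; split => [|x]; rewrite ?trmx0 ?oppr0// mulvE trmx0 mulmx0 addr0.
by move=> i; apply: polyfun_ext (polyfun_cst _ _ 0) => x; rewrite mxE.
Qed.

Lemma VkZ a (p : vec -> vec) : Vk k p -> Vk k (fun x => a *: p x).
Proof.
rewrite /Vk; case: eqP => _.
  move=> [c [B [Bs pE]]]; exists (a *: c), (a *: B); split => [|x].
    by rewrite linearZ /= Bs scalerN.
  by rewrite pE mulvZl scalerDr.
move=> pp i; apply: polyfun_ext (polyfunZ a (pp i)) => x; by rewrite mxE.
Qed.

(* For [p x = a + B x] and [y] tangential to [F], [(n . B y) n] is the image of [y]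
   under the skew matrix [tens n (n B) - tens (n B) n]. *)
Lemma rigid_normal_part (p : vec -> vec) : k = 0%N -> Vk k p ->
  exists2 w, Vk k w & forall x, fext F w x =
    2 *: fext F p x - ip (fext F p x) nu *: nu.
Proof.
move=> k0; rewrite /Vk k0 eqxx => -[a [B [Bs pE]]].
pose wv := nu *m B; pose o := forig F.
pose B' := tens nu wv - tens wv nu.
pose a' := ip (p o) nu *: nu - mulv B' o.
exists (fun x => (2 *: a - a') + mulv (2 *: B - B') x).
  exists (2 *: a - a'), (2 *: B - B'); split => //.
  by rewrite linearB linearZ /= Bs /B' linearB /= !tens_tr scalerN !opprB addrC.
move=> x; rewrite /fext -/o; set X := x - _ *: _.
have hX : ip (X - o) nu = 0.
  by rewrite /X addrAC (ipBl (x - o)) ipZl (nrm_ip1 wfF) mulr1 subrr.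
have pX : ip (p X) nu = ip (p o) nu + ip wv (X - o).
  rewrite !pE !ipDl -addrA; congr (_ + _).
  by rewrite ip_mulv ip_mulv -/wv ipBr !(ipC wv) addrC subrK.
have BX : mulv B' (X - o) = ip wv (X - o) *: nu.
  by rewrite /B' mulvDl mulvNl !mulv_tens [ip nu _]ipC hX scale0r subr0.
rewrite pX [(_ + ip wv _) *: _]scalerDl -BX mulvDr mulvNr.
rewrite mulvDl mulvZl mulvNl [p X]pE /a' scalerDr.
by apply/rowP => i; rewrite !mxE; ring.
Qed.

Lemma sigma1_polyfun (p : vec -> vec) m : polyvec m p ->
  forall i j, polyfun m (fun x => sigma1 p x i j).
Proof.
move=> pp i j.
have pe l : polyfun m (fun x => fext F p x 0 l) by exact: (polyfun_fext F (pp l)).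
have pip : polyfun m (fun x => ip (fext F p x) nu).
  apply: (@polyfun_ext _ _ _ (fun x => \sum_j nu 0 j * fext F p x 0 j)).
    by move=> x; rewrite ip_rV; apply: eq_bigr => l _; rewrite mulrC.
  by apply: polyfun_sum => l _; exact: polyfunZ.
have pq l : polyfun m (fun x => (2 *: fext F p x - ip (fext F p x) nu *: nu) 0 l).
  apply: (@polyfun_ext _ _ _ (fun x => 2 * fext F p x 0 l - nu 0 l * ip (fext F p x) nu)).
    by move=> x; rewrite !mxE [nu 0 l * _]mulrC.
  by apply: polyfunB; exact: polyfunZ.
apply: (@polyfun_ext _ _ _ (fun x => 2^-1 *
   (nu 0 j * (2 *: fext F p x - ip (fext F p x) nu *: nu) 0 i +
    nu 0 i * (2 *: fext F p x - ip (fext F p x) nu *: nu) 0 j))).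
  by move=> x; rewrite /sigma1 symmE ![nu 0 _ * _]mulrC.
by apply: polyfunZ; apply: polyfunD; exact: polyfunZ.
Qed.

(** For [k = 0] the normal part is admissible by [rigid_normal_part] and the tangential part, of
    degree 0, is constant. For [k >= 1] extending along the normal keeps the degree. *)
Lemma Sigmak_mem a (p : vec -> vec) (tau : vec -> 'M[R]_d.+1) : Vk k p ->
  (forall x, tangS F (tau x)) -> (forall i j, polyfun k (fun x => tau x i j)) ->
  Sigmak k F (fun x => a *: sigma1 p x + tau x).
Proof.
move=> Vp tt pt; rewrite /Sigmak; case: eqP => [k0|/eqP k0].
  have [w Vw wE] := rigid_normal_part k0 Vp.
  exists (fun x => a *: w x), (tau 0); split => //; first exact: VkZ.
  move=> x; rewrite [fext F _ x](_ : _ = a *: fext F w x)// wE tensZ symmZ; congr (_ + _).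
  by apply/matrixP => i j; have := pt i j; rewrite k0 => /polyfun0_cst/(_ x).
split=> [x|i j].
  by rewrite linearD linearZ /= symm_tr (tangS_tr (tt x)).
have pp : polyvec k p by move: Vp; rewrite /Vk (negbTE k0).
apply: (@polyfun_ext _ _ _ (fun x => a * sigma1 p x i j + tau x i j)).
  by move=> x; rewrite !mxE.
by apply: polyfunD => //; apply: polyfunZ; exact: sigma1_polyfun.
Qed.

Lemma projF_Vk (g : vec -> vec) : Vk k (projF k F g).
Proof.
rewrite /projF; set P := (P in xget _ P).
have [[p Pp]|nP] := pselect (exists p, P p).
  by have [] : P (xget (fun=> 0) P) by apply: xgetPex; exists p.
rewrite xgetPN; first exact: Vk0.
by move=> p Pp; apply: nP; exists p.
Qed.

(** Either the projection has its defining property, which is tested with the projection itself, or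
    [projF] takes its default value 0 and both sides vanish. *)
Lemma projF_orth (g : vec -> vec) : tame (fbase F) -> (forall i, ispoly (fun x => g x 0 i)) ->
  fint F (fun x => ip (projF k F g x) (g x)) =
  fint F (fun x => ip (projF k F g x) (projF k F g x)).
Proof.
move=> tF pg; have Vp := projF_Vk g.
have [|E] : (forall q, Vk k q -> fint F (fun x => ip (g x - projF k F g x) (q x)) = 0) \/
    projF k F g = fun=> 0.
- rewrite /projF; set P := (P in xget _ P).
  have [[p Pp]|nP] := pselect (exists p, P p); [left|right].
    by have [] : P (xget (fun=> 0) P) by apply: xgetPex; exists p.
  by rewrite xgetPN// => p Pp; apply: nP; exists p.
- set p := projF k F g in Vp *; move=> /(_ _ Vp) E.
  have pp i : ispoly (fun y => p (Defs.fmap F y) 0 i).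
    by exists k.+1; exact: (polyfun_fmap F (Vk_polyvec Vp i)).
  have pgf i : ispoly (fun y => g (Defs.fmap F y) 0 i).
    by have [m gm] := pg i; exists m; exact: (polyfun_fmap F gm).
  apply/eqP; rewrite -subr_eq0 -E /fint -vintB//; last 2 first.
  + rewrite [X in ispoly X](_ : _ = fun y => \sum_i p (Defs.fmap F y) 0 i * g (Defs.fmap F y) 0 i).
      by apply: ispoly_sum => i _; exact: ispolyM.
    by apply/funext => y; rewrite /= ip_rV.
  + rewrite [X in ispoly X](_ : _ = fun y => \sum_i p (Defs.fmap F y) 0 i * p (Defs.fmap F y) 0 i).
      by apply: ispoly_sum => i _; exact: ispolyM.
    by apply/funext => y; rewrite /= ip_rV.
  by apply/eqP; apply: eq_vint => y _; rewrite /= ipBl [ip (p _) (g _)]ipC.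
by rewrite E; apply: eq_vint => y _; rewrite /= !ip0l.
Qed.

End NormalTensors.

(** * Bounds for tensor fields and the tangential tensor of an element *)

Section MatrixBounds.
Variable R : realType.

Lemma ispoly_ip n p q (A B : 'rV[R]_n -> 'M[R]_(p, q)) :
  (forall i j, ispoly (fun x => A x i j)) -> (forall i j, ispoly (fun x => B x i j)) ->
  ispoly (fun x => ip (A x) (B x)).
Proof.
move=> pA pB; rewrite (_ : (fun _ => _) = fun x => \sum_i \sum_j A x i j * B x i j).
  by apply: ispoly_sum => i _; apply: ispoly_sum => j _; exact: ispolyM.
by apply/funext => x; rewrite ipE.
Qed.

Lemma vint_ip n p q (D : set 'rV[R]_n) (A : 'rV[R]_n -> 'M[R]_(p, q)) : tame D ->
  (forall i j, ispoly (fun x => A x i j)) ->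
  vint D (fun x => ip (A x) (A x)) = \sum_i \sum_j vint D (fun x => A x i j ^+ 2).
Proof.
move=> tD pA; rewrite (_ : (fun x => ip _ _) = fun x => \sum_i \sum_j A x i j ^+ 2); last first.
  apply/funext => x; rewrite ipE; apply: eq_bigr => i _; apply: eq_bigr => j _.
  by rewrite expr2.
rewrite vint_sum// => [|i _]; last by apply: ispoly_sum => j _; exact: ispolyX.
by apply: eq_bigr => i _; rewrite vint_sum// => j _; exact: ispolyX.
Qed.

Lemma conditioning_bound n N (kappa : R) (b : 'I_N -> 'M[R]_n) : conditioning_le kappa b ->
  (forall l, enorm (b l) = 1) -> forall (c : 'I_N -> R) A,
  A = \sum_l c l *: b l -> ip A A <= `|kappa| * \sum_l ip A (b l) ^+ 2.
Proof.
case: N b => [|N] b cond b1 c A AE.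
  rewrite {1}AE big_ord0 ip0l mulr_ge0//; apply: sumr_ge0 => l _; exact: sqr_ge0.
set S := \sum_l _.
have S0 : 0 <= S by apply: sumr_ge0 => l _; exact: sqr_ge0.
have A0 := ip_ge0 A.
(* The conditioning inequality, compared with the first unit vector and [enorm (b 0) = 1], bounds
   the coefficients of [A]. *)
have cA : \sum_l c l ^+ 2 <= `|kappa| * ip A A.
  have := cond (delta_mx 0 0) (\row_l c l).
  rewrite (_ : \sum_i _ = b 0); last first.
    rewrite (bigD1 0)//= !mxE eqxx scale1r big1 ?addr0// => l /negbTE l0.
    by rewrite mxE l0 andbF scale0r.
  rewrite b1 expr1n mul1r !enorm_sqr.
  rewrite (_ : \sum_i (\row_l c l) 0 i *: b i = A); last first.
    by rewrite AE; apply: eq_bigr => l _; rewrite mxE.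
  rewrite (_ : ip (delta_mx 0 0) _ = 1); last first.
    rewrite ip_rV (bigD1 0)//= !mxE eqxx mulr1 big1 ?addr0// => l /negbTE l0.
    by rewrite !mxE l0 andbF mulr0.
  rewrite mulr1 ip_rV => h.
  apply: le_trans (_ : _ <= kappa * ip A A) _.
    by apply: le_trans h; apply: ler_sum => l _; rewrite mxE expr2.
  by apply: ler_wpM2r => //; exact: ler_norm.
have [A00|Ap] := eqVneq (ip A A) 0; first by rewrite A00 mulr_ge0.
have Apos : 0 < ip A A by rewrite lt0r Ap.
have : ip A A ^+ 2 <= (\sum_l c l ^+ 2) * S.
  rewrite {1}(_ : ip A A = \sum_l c l * ip A (b l)); first exact: sqr_sum_le.
  by rewrite {1}AE ip_suml; apply: eq_bigr => l _; rewrite ipZl ipC.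
move=> h; rewrite -(ler_pM2r Apos) -expr2; apply: le_trans h _.
apply: le_trans (ler_wpM2r S0 cA) _.
by rewrite mulrAC.
Qed.

(** A face is incident to [side1], possibly to [side2], and to no other element. *)
Lemma sum_incident_le n (M : mesh R n) (a : face M -> R) : (forall F, 0 <= a F) ->
  \sum_(K : elt M) \sum_(F | incident K F) a F <= 2 * \sum_F a F.
Proof.
move=> a0; under eq_bigr do rewrite big_mkcond; rewrite exchange_big /= mulr_sumr.
apply: ler_sum => F _.
apply: le_trans (_ : _ <= \sum_(K : elt M) ((if side1 F == K then a F else 0) +
    (if side2 F == Some K then a F else 0))) _.
  apply: ler_sum => K _; rewrite /incident.
  by case: (side1 F == K); case: (side2 F == Some K); rewrite /= ?addr0 ?add0r ?lerDl.
rewrite big_split/= -!big_mkcond/= mulr2n mulrDl mul1r; apply: lerD.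
  by rewrite (big_pred1 (side1 F)).
case: (side2 F) => [K|]; last by rewrite big_pred0.
by rewrite (big_pred1 K).
Qed.

Variables (d : nat) (rhoK rhoT : R).
Hypothesis d0 : (0 < d)%N.

Lemma pyr_sum_bound_mx m : exists2 C : R, 0 < C &
  forall Omega (M : mesh R d.+1), is_mesh M Omega -> shape_regular M rhoK rhoT ->
  forall (K : elt M) (G : 'rV[R]_d.+1 -> 'M[R]_d.+1),
    (forall i j, polyfun m (fun x => G x i j)) ->
    \sum_(F | incident K F) vint (pyr K F) (fun x => ip (G x) (G x)) <=
      C * vint (cell K) (fun x => ip (G x) (G x)).
Proof.
have [C C0 HC] := pyr_sum_bound rhoK rhoT d0 m.
exists C => // Omega M isM sr K G pG.
have pG' i j : ispoly (fun x => G x i j) by exists m.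
rewrite (vint_ip (cell_tame isM K))//.
under eq_bigr => F KF do rewrite (vint_ip (pyr_tame isM KF))//.
rewrite exchange_big mulr_sumr; apply: ler_sum => i _ /=.
rewrite exchange_big mulr_sumr; apply: ler_sum => j _ /=.
exact: HC isM sr _ _ (pG i j).
Qed.

Lemma face_extension_bound_vec m : exists2 C : R, 0 < C &
  forall Omega (M : mesh R d.+1), is_mesh M Omega -> shape_regular M rhoK rhoT ->
  forall (K : elt M) (F : face M) (p : 'rV[R]_d.+1 -> 'rV[R]_d.+1), incident K F ->
    polyvec m p ->
    vint (pyr K F) (fun x => ip (fext (facet_of F) p x) (fext (facet_of F) p x)) <=
      C * diam (Defs.fset F) * fint (facet_of F) (fun x => ip (p x) (p x)).
Proof.
have [C C0 HC] := face_extension_bound rhoK rhoT d0 m.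
exists C => // Omega M isM sr K F p KF pp.
rewrite (vint_ip (pyr_tame isM KF)) => [|i j]; last first.
  by rewrite ord1; exists m; exact: (polyfun_fext (facet_of F) (pp j)).
rewrite big_ord1 /fint [X in _ <= _ * X](vint_ip (fbase_tame isM F)) => [|i j]; last first.
  by rewrite ord1; exists m; exact: (polyfun_fmap (facet_of F) (pp j)).
rewrite big_ord1 mulr_sumr; apply: ler_sum => j _.
exact: (HC _ _ isM sr K F (fun x => p x 0 j) KF (pp j)).
Qed.

(** On one element [tau] has the opposite sign of the strain part of the test tensor, so that its
    product with the strain is a sum of squares. Summands 1 in the constants only ensure
    positivity. *)
Lemma interior_tensor (kappa : R) k : exists C1 C2 : R, [/\ 0 < C1, 0 < C2 &
  forall Omega (M : mesh R d.+1), is_mesh M Omega -> shape_regular M rhoK rhoT ->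
  tangential_bases M kappa ->
  forall (K : elt M) (v : 'rV[R]_d.+1 -> 'rV[R]_d.+1), polyvec k.+1 v ->
  exists tau : face M -> 'rV[R]_d.+1 -> 'M[R]_d.+1,
  [/\ forall F x, incident K F -> tangS (facet_of F) (tau F x),
      forall F i j, polyfun k (fun x => tau F x i j),
      \sum_(F | incident K F) vint (pyr K F) (fun x => ip (tau F x) (tau F x)) <=
        C2 * vint (cell K) (fun x => ip (eps v x) (eps v x)) &
      vint (cell K) (fun x => ip (eps v x) (eps v x)) <=
        C1 * \sum_(F | incident K F) vint (pyr K F) (fun x => ip (tau F x) (eps v x))]].
Proof.
have [C C0 HC] := cell_pyr_bound rhoK rhoT d0 k.
pose N := (d.+1 * d.+2)./2.
exists ((`|kappa| + 1) * C), (N%:R * N%:R + 1); split.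
- by rewrite mulr_gt0// ltr_wpDl.
- by rewrite ltr_wpDl// mulr_ge0.
move=> Omega M isM sr tb K v pv; have [b [sel]] := tb K.
rewrite -/N in sel *; set bl := fun l => _; move=> /= [basis selK span b1 cond].
have b1' l : ip (bl l) (bl l) = 1 by rewrite -enorm_sqr b1 expr1n.
have pe := eps_polyfun pv; set e := eps v in pe *.
have pe' i j : ispoly (fun x => e x i j) by exists k.
pose a l x := ip (e x) (bl l).
have pa l : polyfun k (a l).
  apply: (@polyfun_ext _ _ _ (fun x => \sum_i \sum_j bl l i j * e x i j)).
    move=> x; rewrite /a ipE; apply: eq_bigr => i _; apply: eq_bigr => j _.
    by rewrite mulrC.
  by apply: polyfun_sum => i _; apply: polyfun_sum => j _; exact: polyfunZ.
have pa2 l : ispoly (fun x => a l x ^+ 2) by apply: ispolyX; exists k.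
pose tau F x := \sum_(l | (sel l).1 == F) a l x *: bl l.
have ptau F i j : polyfun k (fun x => tau F x i j).
  apply: (@polyfun_ext _ _ _ (fun x => \sum_(l | (sel l).1 == F) bl l i j * a l x)).
    by move=> x; rewrite /tau summxE; apply: eq_bigr => l _; rewrite mxE mulrC.
  by apply: polyfun_sum => l _; exact: polyfunZ.
have ptau' F i j : ispoly (fun x => tau F x i j) by exists k.
have tc := cell_tame isM K.
have ale l x : a l x ^+ 2 <= ip (e x) (e x).
  by apply: le_trans (ip_CS _ _) _; rewrite b1' mulr1.
(* Every index [l] is selected for exactly one face, so double sums over faces and indices have [N]
   terms however many faces [K] has. *)
have part (f : face M -> 'I_N -> R) :
    \sum_(F | incident K F) \sum_(l | (sel l).1 == F) f F l = \sum_l f (sel l).1 l.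
  rewrite [RHS](partition_big (fun l => (sel l).1) (fun F => incident K F))/=; last first.
    by move=> l _; exact: selK.
  by apply: eq_bigr => F _; apply: eq_bigr => l /eqP ->.
exists tau; split => //.
- move=> F x KF; apply: tangS_sum => l /eqP lF; apply: tangSZ.
  by have [H _] := basis _ (selK l); rewrite /bl -lF; exact: H.
- have tt F x : ip (tau F x) (tau F x) <= N%:R * \sum_(l | (sel l).1 == F) a l x ^+ 2.
    pose a' l := if (sel l).1 == F then a l x else 0.
    have -> : tau F x = \sum_l a' l *: bl l.
      rewrite /tau big_mkcond; apply: eq_bigr => l _; rewrite /a'.
      by case: ifP => // _; rewrite scale0r.
    have := @ip_sum_le R d.+1 'I_N a' bl; rewrite card_ord.
    have -> : \sum_l a' l ^+ 2 = \sum_(l | (sel l).1 == F) a l x ^+ 2.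
      rewrite [RHS]big_mkcond; apply: eq_bigr => l _; rewrite /a'.
      by case: ifP => // _; rewrite expr0n.
    by apply => l; rewrite b1'.
  apply: le_trans (_ : _ <= \sum_(F | incident K F) \sum_(l | (sel l).1 == F)
      N%:R * vint (cell K) (fun x => ip (e x) (e x))) _.
    apply: ler_sum => F KF; rewrite -mulr_sumr.
    apply: le_trans (_ : _ <= vint (pyr K F) (fun x => N%:R * \sum_(l | (sel l).1 == F) a l x ^+ 2)) _.
      apply: le_vint; [exact: (pyr_tame isM KF)|exact: ispoly_ip| |by move=> x _; exact: tt].
      by apply: ispolyZ; apply: ispoly_sum => l _.
    rewrite vintZ; [|exact: (pyr_tame isM KF)|by apply: ispoly_sum].
    rewrite vint_sum//; last exact: (pyr_tame isM KF).
    apply: ler_wpM2l => //; apply: ler_sum => l _.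
    apply: le_trans (_ : _ <= vint (cell K) (fun x => a l x ^+ 2)) _.
      apply: vint_subset => //; first by have [] := pyr_tame isM KF.
        by move=> x _; exact: sqr_ge0.
      exact: (pyr_cell isM KF).
    by apply: le_vint => //; exact: ispoly_ip.
  rewrite (part (fun _ _ => _)) sumr_const card_ord -[leLHS]mulr_natl mulrA.
  apply: ler_wpM2r; last by rewrite lerDl.
  by apply: vint_ge0 => x _; exact: ip_ge0.
have ee x : ip (e x) (e x) <= `|kappa| * \sum_l a l x ^+ 2.
  have [c ec] : exists c : 'I_N -> R, e x = \sum_l c l *: bl l.
    by apply/span; exact: eps_sym.
  exact: conditioning_bound cond b1 c _ ec.
apply: le_trans (_ : _ <= vint (cell K) (fun x => `|kappa| * \sum_l a l x ^+ 2)) _.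
  by apply: le_vint => //; [exact: ispoly_ip|apply: ispolyZ; exact: ispoly_sum].
rewrite vintZ//; last exact: ispoly_sum.
rewrite vint_sum// -mulrA.
(* Each square [a l ^ 2] is brought from the element to the pyramid carrying [b_l], where together
   they form [ip tau eps]. *)
set Z := C * _; have ZE : \sum_l vint (cell K) (fun x => a l x ^+ 2) <= Z.
  rewrite /Z mulr_sumr.
  apply: le_trans (_ : _ <= \sum_l C * vint (pyr K (sel l).1) (fun x => a l x ^+ 2)) _.
    by apply: ler_sum => l _; exact: (HC _ _ isM sr).
  rewrite -(part (fun F l => C * vint (pyr K F) (fun x => a l x ^+ 2))).
  apply: ler_sum => F KF; rewrite -mulr_sumr ler_pM2l// -vint_sum//; last exact: (pyr_tame isM KF).
  rewrite le_eqVlt; apply/orP; left; apply/eqP; apply: eq_vint => x _.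
  rewrite /tau ip_suml; apply: eq_bigr => l _.
  by rewrite ipZl [ip (bl l) _]ipC expr2.
apply: le_trans (ler_wpM2l (normr_ge0 _) ZE) _.
apply: ler_wpM2r; last by rewrite lerDl.
by apply: le_trans ZE; apply: sumr_ge0 => l _; apply: vint_ge0 => x _; exact: sqr_ge0.
Qed.

End MatrixBounds.

(** * The test tensor and the inf-sup condition *)

Lemma le_sqrt_mul (R : rcfType) (c x y : R) : 0 <= c -> 0 <= x -> 0 <= y ->
  x ^+ 2 <= c * y ^+ 2 -> x <= Num.sqrt c * y.
Proof.
move=> c0 x0 y0 le; rewrite -(ger0_norm x0) -(ger0_norm y0) -!sqrtr_sqr -sqrtrM//.
exact: ler_wsqrtr.
Qed.

Section Arithmetic.
Variable R : realFieldType.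

Lemma lower_arith (SE Sa X u v Cp : R) : 0 <= X -> 0 <= Sa -> 0 <= Cp ->
  SE + Sa <= 2 * (Sa - u) -> - u <= Cp * X + v -> v <= SE / 4 ->
  SE + Sa <= 4 * (Cp + 1) * (X + Sa).
Proof. by move=> X0 Sa0 Cp0; have := mulr_ge0 Cp0 Sa0; lra. Qed.

Lemma upper_arith (SE Sa X X1 T c A C : R) : 0 <= SE -> 0 <= Sa -> 0 <= c ->
  0 <= A -> 0 <= C -> X <= 2 * X1 + 2 * A * T -> X1 <= c * Sa -> T <= C * SE ->
  X + Sa <= (2 * c + 1 + 2 * A * C) * (SE + Sa).
Proof.
move=> SE0 Sa0 c0 A0 C0 h1 h2 /(ler_wpM2l A0) h3.
have := mulr_ge0 c0 SE0; have := mulr_ge0 (mulr_ge0 A0 C0) Sa0; lra.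
Qed.

End Arithmetic.

Section InfSup.
Variables (R : realType) (d k : nat) (rhoK rhoT kappa : R).
Hypothesis d0 : (0 < d)%N.
Local Notation vec := 'rV[R]_d.+1.

Lemma norm0h_sqr (M : mesh R d.+1) (tau : broken_mx M) :
  (forall F : face M, 0 <= diam (Defs.fset F)) ->
  norm0h tau ^+ 2 = \sum_K \sum_(F | incident K F) vint (pyr K F) (fun x => ip (tau K F x) (tau K F x))
    + \sum_F diam (Defs.fset F) * fint (facet_of F) (fun x => ip (sigman tau F x) (sigman tau F x)).
Proof.
move=> h0; rewrite /norm0h sqr_sqrtr; last first.
  apply: addr_ge0.
    apply: sumr_ge0 => K _; apply: sumr_ge0 => F _.
    by apply: vint_ge0 => x _; exact: sqr_ge0.
  apply: sumr_ge0 => F _; apply: mulr_ge0 => //.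
  by apply: vint_ge0 => x _; exact: sqr_ge0.
congr (_ + _).
  apply: eq_bigr => K _; apply: eq_bigr => F _; apply: eq_vint => x _.
  exact: enorm_sqr.
apply: eq_bigr => F _; congr (_ * _); apply: eq_vint => x _.
exact: enorm_sqr.
Qed.

Lemma norm1h_sqr (M : mesh R d.+1) (u : broken_vec M) :
  (forall F : face M, 0 <= diam (Defs.fset F)) ->
  norm1h k u ^+ 2 = \sum_K vint (cell K) (fun x => ip (eps (u K) x) (eps (u K) x))
    + \sum_F (diam (Defs.fset F))^-1 * fint (facet_of F)
       (fun x => ip (projF k (facet_of F) (jump u F) x) (projF k (facet_of F) (jump u F) x)).
Proof.
move=> h0; rewrite /norm1h sqr_sqrtr; last first.
  apply: addr_ge0.
    by apply: sumr_ge0 => K _; apply: vint_ge0 => x _; exact: sqr_ge0.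
  apply: sumr_ge0 => F _; apply: mulr_ge0; first by rewrite invr_ge0.
  by apply: vint_ge0 => x _; exact: sqr_ge0.
congr (_ + _).
  by apply: eq_bigr => K _; apply: eq_vint => x _; exact: enorm_sqr.
apply: eq_bigr => F _; congr (_ * _); apply: eq_vint => x _.
exact: enorm_sqr.
Qed.

Lemma norm0h_ge0 (M : mesh R d.+1) (tau : broken_mx M) : 0 <= norm0h tau.
Proof. by rewrite /norm0h sqrtr_ge0. Qed.

Lemma norm1h_ge0 (M : mesh R d.+1) (u : broken_vec M) : 0 <= norm1h k u.
Proof. by rewrite /norm1h sqrtr_ge0. Qed.

Lemma jump_polyfun (M : mesh R d.+1) (u : broken_vec M) F : Uh k u ->
  forall i, ispoly (fun x => jump u F x 0 i).
Proof.
move=> Uu i; exists k.+1.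
apply: (@polyfun_ext _ _ _ (fun x => u (side1 F) x 0 i -
   (if side2 F is Some K2 then u K2 x 0 i else 0))).
  by move=> x; rewrite /jump mxE; congr (_ + _); rewrite mxE; case: (side2 F) => //; rewrite mxE.
apply: polyfunB; first exact: Uu.
by case: (side2 F) => [K2|]; [exact: Uu|exact: polyfun_cst].
Qed.

(** The last bound serves to exclude [norm0h sigma = 0], where the quotient would be a division by
    zero. *)
Lemma test_tensor : exists C3 C4 : R, [/\ 0 < C3, 0 < C4 &
  forall Omega (M : mesh R d.+1), is_mesh M Omega -> shape_regular M rhoK rhoT ->
  tangential_bases M kappa -> forall u : broken_vec M, Uh k u ->
  exists sigma : broken_mx M, [/\ Sigmah k sigma,
    norm1h k u ^+ 2 <= 2 * bh sigma u,
    norm0h sigma ^+ 2 <= C4 * norm1h k u ^+ 2 &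
    norm1h k u ^+ 2 <= C3 * norm0h sigma ^+ 2]].
Proof.
have [Cf Cf0 HCf] := face_extension_bound_vec rhoK rhoT d0 k.+1.
have [Cp Cp0 HCp] := pyr_sum_bound_mx rhoK rhoT d0 k.
have [C1 [C2 [C10 C20 Hint]]] := interior_tensor rhoK rhoT d0 kappa k.
(* 10 from [sigma1_ip], doubled because a face belongs to at most two elements. *)
pose c1 : R := 20 * Cf.
have c10 : 0 < c1 by rewrite mulr_gt0.
(* The factor [C1] undoes [SE <= C1 * Z]; the term [c1 * Cp / 2] absorbs the cross term and [2^-1]
   is what remains for the strain. *)
pose A : R := C1 * (c1 * Cp / 2 + 2^-1).
have A0 : 0 < A by rewrite mulr_gt0// addr_gt0// ?divr_gt0 ?mulr_gt0.
exists (4 * (Cp + 1)), (2 * c1 + 1 + 2 * A ^+ 2 * C2); split.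
- by rewrite mulr_gt0// addr_gt0.
- by have := mulr_gt0 (exprn_gt0 2 A0) C20; move: c10; lra.
move=> Omega M isM sr tb u Uu.
have h0 F : 0 < diam (Defs.fset F) := mesh_face_diam_gt0 d0 F isM sr.
have h0' F : 0 <= diam (Defs.fset F) := ltW (h0 F).
have wf F := mesh_facet isM F.
have /choice[tau Htau] K : exists tau : face M -> vec -> 'M[R]_d.+1,
  [/\ forall F x, incident K F -> tangS (facet_of F) (tau F x),
      forall F i j, polyfun k (fun x => tau F x i j),
      \sum_(F | incident K F) vint (pyr K F) (fun x => ip (tau F x) (tau F x)) <=
        C2 * vint (cell K) (fun x => ip (eps (u K) x) (eps (u K) x)) &
      vint (cell K) (fun x => ip (eps (u K) x) (eps (u K) x)) <=
        C1 * \sum_(F | incident K F) vint (pyr K F) (fun x => ip (tau F x) (eps (u K) x))].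
  exact: Hint isM sr tb K (u K) (Uu K).
pose p (F : face M) := projF k (facet_of F) (jump u F).
have Vp F : Vk k (p F) by exact: projF_Vk.
have pp F : polyvec k.+1 (p F) by exact: Vk_polyvec.
pose h (F : face M) := diam (Defs.fset F).
pose sgn (K : elt M) (F : face M) : R :=
  Num.sg (ip (forig (facet_of F) - Defs.center K) (fnrm (facet_of F))).
have sgn2 K F : incident K F -> sgn K F * sgn K F = 1.
  move=> KF; have [r [c [y [_ _ _ _ H0]]]] := mesh_geometry d0 isM sr KF.
  by rewrite -expr2 /sgn sqr_sg H0.
(* [sgn] cancels the orientation in [outn], and the two sides get opposite signs: the outward normal
   components are [p / h] on [side1] and [- p / h] on the other side, so their sum vanishes. *)
pose s (K : elt M) (F : face M) := (if side1 F == K then sgn K F else - sgn K F) / h F.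
have s2 K F : incident K F -> s K F * s K F = (h F)^-1 ^+ 2.
  move=> KF; have E := sgn2 _ _ KF; rewrite /s; case: ifP => _;
    by rewrite ?mulNr ?mulrN ?opprK mulrACA E mul1r expr2.
pose S1 (K : elt M) (F : face M) x := s K F *: sigma1 (facet_of F) (p F) x.
pose sigma (K : elt M) (F : face M) x := S1 K F x + - A *: tau K F x.
have outnE K F : outn K F = sgn K F *: fnrm (facet_of F) by [].
have mulv_sigma K F x : incident K F ->
    mulv (sigma K F x) (outn K F) = (s K F * sgn K F) *: fext (facet_of F) (p F) x.
  move=> KF; have [tt _ _ _] := Htau K.
  rewrite outnE mulvZr /sigma mulvDl /S1 (mulvZl (s K F)) (mulvZl (- A)).
  rewrite (sigma1_normal (wf F)) (tangS_mulv (tt F x KF)).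
  by rewrite scaler0 addr0 scalerA mulrC.
have inc1 F : incident (side1 F) F by rewrite /incident eqxx.
have sigman_E F x : Defs.fset F x -> sigman sigma F x = (h F)^-1 *: p F x.
  move=> Fx; rewrite /sigman mulv_sigma// (fext_fset (wf F) _ Fx); congr (_ *: _).
  by rewrite /s eqxx mulrAC sgn2// mul1r.
have pS1 K F i j : ispoly (fun x => S1 K F x i j).
  exists k.+1; apply: (@polyfun_ext _ _ _ (fun x => s K F * sigma1 (facet_of F) (p F) x i j)).
    by move=> x; rewrite [RHS]mxE.
  by apply: polyfunZ; exact: sigma1_polyfun (pp F) i j.
have ptau K F i j : ispoly (fun x => tau K F x i j).
  by have [_ pt _ _] := Htau K; exists k; exact: pt.
have psig K F i j : ispoly (fun x => sigma K F x i j).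
  rewrite (_ : (fun _ => _) = fun x => S1 K F x i j + - A * tau K F x i j).
    by apply: ispolyD => //; exact: ispolyZ.
  by apply/funext => x; rewrite [LHS]mxE; congr (_ + _); exact: mxE.
have peps K i j : ispoly (fun x => eps (u K) x i j).
  by exists k; exact: (eps_polyfun (Uu K) i j).
have Sig : Sigmah k sigma.
  split=> [K F KF|F K2 side2F x Fx].
    have [tt pt _ _] := Htau K; apply: Sigmak_mem => //.
      by move=> x; apply: tangSZ; exact: tt.
    move=> i j; apply: (@polyfun_ext _ _ _ (fun x => - A * tau K F x i j)).
      by move=> x; rewrite [RHS]mxE.
    by apply: polyfunZ; exact: pt.
  have inc2 : incident K2 F by rewrite /incident side2F eqxx orbT.
  have ne : side1 F == K2 = false.
    by apply/negP => /eqP E; have := mesh_sides isM F; rewrite side2F E eqxx.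
  rewrite !mulv_sigma// -scalerDl /s eqxx ne mulrAC sgn2// mul1r.
  by rewrite mulrAC mulNr sgn2// mulN1r subrr scale0r.
pose E (K : elt M) := vint (cell K) (fun x => ip (eps (u K) x) (eps (u K) x)).
pose a (F : face M) := (h F)^-1 * fint (facet_of F) (fun x => ip (p F x) (p F x)).
have E0 K : 0 <= E K by apply: vint_ge0 => x _; exact: ip_ge0.
have a0 F : 0 <= a F.
  apply: mulr_ge0; first by rewrite invr_ge0; exact: h0'.
  by apply: vint_ge0 => x _; exact: ip_ge0.
pose SE := \sum_K E K; pose Sa := \sum_F a F.
have SE0 : 0 <= SE by exact: sumr_ge0.
have Sa0 : 0 <= Sa by exact: sumr_ge0.
have N1 : norm1h k u ^+ 2 = SE + Sa by rewrite norm1h_sqr.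
pose X := \sum_K \sum_(F | incident K F) vint (pyr K F) (fun x => ip (sigma K F x) (sigma K F x)).
have pfint F f : (exists m, polyfun m f) -> ispoly (f \o Defs.fmap (facet_of F)).
  by move=> [m pf]; exists m; exact: polyfun_fmap.
have pip_p F : ispoly ((fun x => ip (p F x) (p F x)) \o Defs.fmap (facet_of F)).
  by apply: pfint; apply: ispoly_ip => i j; rewrite ord1; exists k.+1; exact: pp.
have N0 : norm0h sigma ^+ 2 = X + Sa.
  rewrite norm0h_sqr//; congr (_ + _); apply: eq_bigr => F _.
  have -> : fint (facet_of F) (fun x => ip (sigman sigma F x) (sigman sigma F x)) =
      (h F)^-1 ^+ 2 * fint (facet_of F) (fun x => ip (p F x) (p F x)).
    rewrite /fint -vintZ//; last exact: fbase_tame isM F.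
    apply: eq_vint => y Fy /=; rewrite sigman_E; last by exists y.
    by rewrite ipZl ipZr mulrA expr2.
  rewrite mulrA /a; congr (_ * _); rewrite expr2 mulrA divff ?mul1r//.
  exact: lt0r_neq0.
have faceE : \sum_F fint (facet_of F) (fun x => ip (sigman sigma F x) (jump u F x)) = Sa.
  apply: eq_bigr => F _.
  have <- : (h F)^-1 * fint (facet_of F) (fun x => ip (p F x) (jump u F x)) = a F.
    rewrite /a projF_orth//; first exact: fbase_tame isM F.
    exact: jump_polyfun.
  rewrite /fint -vintZ//; last first.
  - apply: pfint; apply: ispoly_ip => i j; rewrite ord1; last exact: jump_polyfun.
    by exists k.+1; exact: pp.
  - exact: fbase_tame isM F.
  by apply: eq_vint => y Fy /=; rewrite sigman_E ?ipZl//; exists y.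
have bhE : bh sigma u = Sa -
    \sum_K \sum_(F | incident K F) vint (pyr K F) (fun x => ip (sigma K F x) (eps (u K) x)).
  by rewrite /bh faceE addrC.
have S1le K F : incident K F ->
    vint (pyr K F) (fun x => ip (S1 K F x) (S1 K F x)) <= 10 * Cf * a F.
  move=> KF; have tT := pyr_tame isM KF.
  have pfe : ispoly (fun x => ip (fext (facet_of F) (p F) x) (fext (facet_of F) (p F) x)).
    apply: ispoly_ip => i j; rewrite ord1; exists k.+1;
      exact: (polyfun_fext (facet_of F) (pp F j)).
  apply: le_trans (_ : _ <= vint (pyr K F) (fun x => ((h F)^-1 ^+ 2 * 10) *
      ip (fext (facet_of F) (p F) x) (fext (facet_of F) (p F) x))) _.
    apply: le_vint => //; first exact: ispoly_ip.
      exact: ispolyZ.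
    move=> x _; rewrite ipZl ipZr mulrA s2// -mulrA; apply: ler_wpM2l; first exact: sqr_ge0.
    exact: sigma1_ip (wf F) _ _.
  rewrite vintZ//.
  have := HCf _ _ isM sr K F (p F) KF (pp F); rewrite -/(h F).
  set V := vint _ _; set J := fint _ _ => VJ.
  have hF2 : 0 <= (h F)^-1 ^+ 2 * 10 by rewrite mulr_ge0// sqr_ge0.
  apply: le_trans (ler_wpM2l hF2 VJ) _.
  rewrite /a -/J le_eqVlt; apply/orP; left; apply/eqP.
  have hn : h F != 0 := lt0r_neq0 (h0 F).
  by field.
pose X1 := \sum_K \sum_(F | incident K F) vint (pyr K F) (fun x => ip (S1 K F x) (S1 K F x)).
have X1le : X1 <= c1 * Sa.
  apply: le_trans (_ : _ <= \sum_K \sum_(F | incident K F) 10 * Cf * a F) _.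
    by apply: ler_sum => K _; apply: ler_sum => F KF; exact: S1le.
  apply: le_trans (sum_incident_le _) _ => [F|].
    by rewrite mulr_ge0// mulr_ge0// ltW.
  rewrite -mulr_sumr /c1 -/Sa le_eqVlt; apply/orP; left; apply/eqP.
  by ring.
(* [bh] integrates over pyramids and [norm1h] over elements; [Cp] links the two. *)
pose Y := \sum_K \sum_(F | incident K F) vint (pyr K F) (fun x => ip (eps (u K) x) (eps (u K) x)).
have Yle : Y <= Cp * SE.
  rewrite /SE mulr_sumr; apply: ler_sum => K _.
  by apply: (HCp _ _ isM sr) => i j; exact: (eps_polyfun (Uu K)).
pose T := \sum_K \sum_(F | incident K F) vint (pyr K F) (fun x => ip (tau K F x) (tau K F x)).
have Tle : T <= C2 * SE.
  by rewrite /SE mulr_sumr; apply: ler_sum => K _; have [_ _ H _] := Htau K.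
pose Z := \sum_K \sum_(F | incident K F) vint (pyr K F) (fun x => ip (tau K F x) (eps (u K) x)).
have Zge : SE <= C1 * Z.
  by rewrite /Z mulr_sumr; apply: ler_sum => K _; have [_ _ _ H] := Htau K.
have sumD (f g : elt M -> face M -> R) :
    \sum_K \sum_(F | incident K F) (f K F + g K F) =
    \sum_K \sum_(F | incident K F) f K F + \sum_K \sum_(F | incident K F) g K F.
  by rewrite -big_split; apply: eq_bigr => K _; rewrite -big_split.
have sumZ c (f : elt M -> face M -> R) :
    \sum_K \sum_(F | incident K F) (c * f K F) = c * \sum_K \sum_(F | incident K F) f K F.
  by rewrite mulr_sumr; apply: eq_bigr => K _; rewrite -mulr_sumr.
have young (G : elt M -> face M -> vec -> 'M[R]_d.+1) (t : R) : 0 < t ->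
    (forall K F i j, ispoly (fun x => G K F x i j)) ->
    \sum_K \sum_(F | incident K F) vint (pyr K F) (fun x => ip (G K F x) (eps (u K) x)) <=
    t / 2 * (\sum_K \sum_(F | incident K F) vint (pyr K F) (fun x => ip (G K F x) (G K F x)))
      + (2 * t)^-1 * Y.
  move=> t0 pG; rewrite -!sumZ -sumD.
  apply: ler_sum => K _; apply: ler_sum => F KF; have tT := pyr_tame isM KF.
  rewrite -!vintZ//; try exact: ispoly_ip.
  rewrite -vintD//; try by apply: ispolyZ; exact: ispoly_ip.
  apply: le_vint => //; first exact: ispoly_ip.
    by apply: ispolyD; apply: ispolyZ; exact: ispoly_ip.
  by move=> x _; exact: ip_young.
have sigma_split : \sum_K \sum_(F | incident K F) vint (pyr K F) (fun x => ip (sigma K F x) (eps (u K) x)) =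
    \sum_K \sum_(F | incident K F) vint (pyr K F) (fun x => ip (S1 K F x) (eps (u K) x)) + - A * Z.
  rewrite -sumZ -sumD; apply: eq_bigr => K _; apply: eq_bigr => F KF.
  have tT := pyr_tame isM KF.
  rewrite -vintZ//; last exact: ispoly_ip.
  rewrite -vintD//; last 2 first.
  - exact: ispoly_ip.
  - by apply: ispolyZ; exact: ispoly_ip.
  by apply: eq_vint => x _; rewrite ipDl; congr (_ + _); exact: ipZl.
have Xle : X <= 2 * X1 + (2 * A ^+ 2) * T.
  rewrite -!sumZ -sumD; apply: ler_sum => K _; apply: ler_sum => F KF.
  have tT := pyr_tame isM KF.
  rewrite -!vintZ//; try exact: ispoly_ip.
  rewrite -vintD//; try by apply: ispolyZ; exact: ispoly_ip.
  apply: le_vint => //; first exact: ispoly_ip.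
    by apply: ispolyD; apply: ispolyZ; exact: ispoly_ip.
  move=> x _; apply: le_trans (ip_sqrD _ _) _.
  rewrite [ip (- A *: _) _]ipZl [ip _ (- A *: _)]ipZr.
  by rewrite le_eqVlt; apply/orP; left; apply/eqP; ring.
have bound1 : SE + Sa <= 2 * bh sigma u.
  have c1i : 0 < c1^-1 by rewrite invr_gt0.
  (* With this weight the cross term is at most [Sa / 2 + c1 * Cp / 2 * SE], which leaves half of
     [Sa] and, after [A * Z], half of [SE]. *)
  have := young S1 c1^-1 c1i pS1; rewrite -/X1 => Y1.
  have AZ : (c1 * Cp / 2 + 2^-1) * SE <= A * Z.
    have -> : A * Z = (c1 * Cp / 2 + 2^-1) * (C1 * Z) by rewrite /A; ring.
    apply: ler_wpM2l => //; apply: addr_ge0; last by rewrite invr_ge0.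
    by apply: divr_ge0 => //; apply: mulr_ge0; exact: ltW.
  have t1 : c1^-1 / 2 * X1 <= Sa / 2.
    apply: le_trans (ler_wpM2l _ X1le) _; first by rewrite divr_ge0// ltW.
    by rewrite le_eqVlt; apply/orP; left; apply/eqP; field; exact: lt0r_neq0.
  have t2 : (2 * c1^-1)^-1 * Y <= c1 * Cp / 2 * SE.
    rewrite invfM invrK; apply: le_trans (ler_wpM2l _ Yle) _.
      by rewrite mulr_ge0// ?invr_ge0// ltW.
    by rewrite le_eqVlt; apply/orP; left; apply/eqP; field.
  rewrite bhE sigma_split; move: Y1 AZ t1 t2.
  rewrite mulrDl; set u1 := \sum_K _; lra.
have Cp2 : 0 < 2 * Cp by rewrite mulr_gt0.
have psigN K F i j : ispoly (fun x => (- sigma K F x) i j).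
  rewrite (_ : (fun _ => _) = fun x => - sigma K F x i j); first exact: ispolyN.
  by apply/funext => x; rewrite mxE.
(* The weight [2 * Cp] turns the strain term into [SE / 4], small enough to be absorbed in
   [lower_arith]. *)
have Y2 : - (\sum_K \sum_(F | incident K F) vint (pyr K F) (fun x => ip (sigma K F x) (eps (u K) x))) <=
    2 * Cp / 2 * X + (2 * (2 * Cp))^-1 * Y.
  have <- : \sum_K \sum_(F | incident K F) vint (pyr K F) (fun x => ip (- sigma K F x) (- sigma K F x)) = X.
    apply: eq_bigr => K _; apply: eq_bigr => F _; apply: eq_vint => x _.
    by rewrite ipNl ipNr opprK.
  apply: le_trans (young (fun K F x => - sigma K F x) (2 * Cp) Cp2 psigN).
  rewrite -mulN1r -[leLHS]sumZ le_eqVlt; apply/orP; left; apply/eqP.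
  apply: eq_bigr => K _; apply: eq_bigr => F KF.
  rewrite -vintZ; [|exact: (pyr_tame isM KF)|exact: ispoly_ip].
  by apply: eq_vint => x _; rewrite [RHS]ipNl mulN1r.
have t3 : (2 * (2 * Cp))^-1 * Y <= SE / 4.
  apply: le_trans (ler_wpM2l _ Yle) _; first by rewrite invr_ge0 mulr_ge0// ltW.
  by rewrite le_eqVlt; apply/orP; left; apply/eqP; field; exact: lt0r_neq0.
have X0 : 0 <= X.
  apply: sumr_ge0 => K _; apply: sumr_ge0 => F _; apply: vint_ge0 => x _; exact: ip_ge0.
have bound2 : SE + Sa <= 4 * (Cp + 1) * (X + Sa).
  move: bound1 Y2; rewrite bhE (_ : 2 * Cp / 2 = Cp); last by field.
  by move=> b1 b2; exact: lower_arith X0 Sa0 (ltW Cp0) b1 b2 t3.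
have bound3 : X + Sa <= (2 * c1 + 1 + 2 * A ^+ 2 * C2) * (SE + Sa).
  exact: upper_arith SE0 Sa0 (ltW c10) (sqr_ge0 A) (ltW C20) Xle X1le Tle.
exists sigma; split; first exact: Sig.
- by rewrite N1.
- by move: bound3; rewrite -N0 -N1.
by move: bound2; rewrite -N0 -N1.
Qed.

(** A constant tangential tensor supported on one pyramid has no normal component on any face, so it
    is admissible and [bh] reduces to one volume integral, whose sign is adjusted. It handles
    displacements with [norm1h u = 0]. *)
Lemma nonneg_test Omega (M : mesh R d.+1) (u : broken_vec M) :
  is_mesh M Omega -> shape_regular M rhoK rhoT -> Uh k u ->
  exists sigma : broken_mx M, [/\ Sigmah k sigma, nonzero_mx sigma & 0 <= bh sigma u].
Proof.
move=> isM sr Uu.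
have [K0 [F0 [x0 [KF0 x0T]]]] : exists (K : elt M) (F : face M) x, incident K F /\ pyr K F x.
  have [_ _ [x Ox]] := mesh_domain isM; move: Ox; rewrite (mesh_cover isM) => -[K _].
  by rewrite (mesh_pyr isM K) => -[F KF Tx]; exists K, F, x.
have wf := mesh_facet isM F0.
pose t : vec := delta_mx 0 (Ordinal d0) *m fframe (facet_of F0).
have tt : ip t t = 1.
  rewrite frame_isom// ip_rV (bigD1 (Ordinal d0))//= big1 => [|j /negbTE jd];
    rewrite !mxE ?eqxx ?mul1r ?addr0//.
  by rewrite jd mul0r.
pose B := symm (tens t t).
have BT : tangS (facet_of F0) B.
  exists 1%N, (fun=> 1), (fun=> t), (fun=> t); split; last by rewrite big_ord1 scale1r.
  by move=> _; split; exact: frame_nrm.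
have B0 : B != 0.
  apply/negP => /eqP B0; have : mulv B t = t.
    rewrite mulv_symm_tens tt !scale1r (_ : t + t = 2 *: t); last by rewrite scaler_nat mulr2n.
    by rewrite scalerA mulVf ?scale1r// pnatr_eq0.
  rewrite B0 mulvE trmx0 mulmx0 => t0.
  by move: tt; rewrite -t0 ip0l => /eqP; rewrite eq_sym oner_eq0.
pose I0 := vint (pyr K0 F0) (fun x => ip B (eps (u K0) x)).
pose e : R := if 0 <= I0 then -1 else 1.
have e0 : e != 0 by rewrite /e; case: ifP => _; rewrite ?oppr_eq0 oner_eq0.
have eI : e * I0 <= 0.
  by rewrite /e; case: ifPn => [I0p|]; [rewrite mulN1r oppr_le0|rewrite -ltNge mul1r => /ltW].
pose sigma : broken_mx M := fun K F _ => if (K == K0) && (F == F0) then e *: B else 0.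
have sT K F x : tangS (facet_of F) (sigma K F x).
  rewrite /sigma; case: ifP => [/andP[_ /eqP ->]|_]; last exact: tangS0.
  exact: tangSZ.
exists sigma; split.
- split=> [K F KF|F K2 _ x _].
    have -> : sigma K F = fun x => 0 *: sigma1 (facet_of F) (fun=> 0) x + sigma K F x.
      by apply/funext => x; rewrite scale0r add0r.
    apply: Sigmak_mem; [exact: mesh_facet isM F|exact: Vk0|exact: sT|].
    move=> i j; exact: polyfun_cst.
  by rewrite !mulvZr !(tangS_mulv (sT _ _ _)) !scaler0 addr0.
- by exists K0, F0, x0; split => //; rewrite /sigma !eqxx scaler_eq0 negb_or e0.
rewrite /bh [X in _ + X]big1 ?addr0; last first.
  move=> F _; rewrite /fint -[RHS](vint0 (fbase (facet_of F))); apply: eq_vint => y _ /=.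
  by rewrite /sigman mulvZr (tangS_mulv (sT _ _ _)) scaler0 ip0l.
rewrite oppr_ge0; apply: sumr_le0 => K _; apply: sumr_le0 => F KF.
have [/andP[/eqP KK /eqP FF]|nKF] := boolP ((K == K0) && (F == F0)).
  rewrite KK FF; apply: le_trans eI; rewrite /I0 -vintZ; last 2 first.
  - exact: (pyr_tame isM KF0).
  - apply: ispoly_ip => i j; first exact: ispoly_cst.
    by exists k; exact: (eps_polyfun (Uu K0)).
  rewrite le_eqVlt; apply/orP; left; apply/eqP; apply: eq_vint => x _.
  by rewrite /sigma !eqxx ipZl.
rewrite -[leRHS](vint0 (pyr K F)) le_eqVlt; apply/orP; left; apply/eqP.
by apply: eq_vint => x _; rewrite /sigma (negbTE nKF) ip0l.
Qed.

End InfSup.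

Theorem lemma3p2 (R : realType) (d k : nat) (hd : (2 <= d)%N)
    (rhoK rhoT kappa : R) :
  exists2 C : R, 0 < C &
    forall (Omega : set 'rV[R]_d) (M : mesh R d),
      is_mesh M Omega ->
      shape_regular M rhoK rhoT ->
      tangential_bases M kappa ->
      forall u : broken_vec M, Uh k u ->
        ((norm1h k u)%:E <=
         C%:E * ereal_sup [set (bh sigma u / norm0h sigma)%:E |
                  sigma in [set sigma : broken_mx M |
                              Sigmah k sigma /\ nonzero_mx sigma]])%E.
Proof.
case: d hd => [//|d]; rewrite ltnS => d0.
have [C3 [C4 [C30 C40 H]]] := test_tensor k rhoK rhoT kappa d0.
have C : 0 < 2 * Num.sqrt C4 by rewrite mulr_gt0// sqrtr_gt0.
exists (2 * Num.sqrt C4) => // Omega M isM sr tb u Uu.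
suff [sigma [Ss nz le]] : exists sigma : broken_mx M, [/\ Sigmah k sigma, nonzero_mx sigma &
    norm1h k u <= 2 * Num.sqrt C4 * (bh sigma u / norm0h sigma)].
  apply: le_trans (_ : (_ <= (2 * Num.sqrt C4)%:E * (bh sigma u / norm0h sigma)%:E)%E) _.
    by rewrite -EFinM lee_fin.
  apply: lee_wpmul2l; first by rewrite lee_fin ltW.
  by apply: ereal_sup_ubound; exists sigma.
set N := norm1h k u; have N0 : 0 <= N := norm1h_ge0 k u.
have [Nz|Npos] := eqVneq N 0.
  have [sigma [Ss nz b0]] := nonneg_test d0 isM sr Uu.
  exists sigma; split => //; rewrite Nz; apply: mulr_ge0; first exact: ltW.
  exact: divr_ge0 b0 (norm0h_ge0 sigma).
have {Npos} Npos : 0 < N by rewrite lt0r Npos.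
have [sigma [Ss b1 b2 b3]] := H _ _ isM sr tb u Uu.
have s0 := norm0h_ge0 sigma.
have spos : 0 < norm0h sigma.
  rewrite lt0r s0 andbT; apply/negP => /eqP sz.
  by have := lt_le_trans (exprn_gt0 2 Npos) b3; rewrite sz expr0n mulr0 ltxx.
exists sigma; split => //.
  apply: contrapT => nz; move: spos; rewrite lt0r => /andP[/negP + _]; apply.
  have z K F x : incident K F -> pyr K F x -> sigma K F x = 0.
    move=> KF Tx; apply/eqP; apply: contrapT => /negP n0; apply: nz.
    by exists K, F, x.
  rewrite -sqrf_eq0 norm0h_sqr => [|F]; last exact: ltW (mesh_face_diam_gt0 d0 F isM sr).
  rewrite !big1 ?addr0// => [F _|K _].
    rewrite /fint (_ : vint _ _ = 0) ?mulr0// -[RHS](vint0 (fbase (facet_of F))).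
    apply: eq_vint => y Fy /=; rewrite /sigman z ?mulvE ?trmx0 ?mulmx0 ?ip0l//.
      by rewrite /incident eqxx.
    by apply: fset_pyr; exists y.
  rewrite big1// => F KF; rewrite -[RHS](vint0 (pyr K F)).
  by apply: eq_vint => x Tx; rewrite z// ip0l.
have sle := le_sqrt_mul (ltW C40) s0 N0 b2.
(* [N * norm0h sigma <= sqrt C4 * N^2 <= 2 * sqrt C4 * bh sigma u]. *)
rewrite mulrA ler_pdivlMr//; apply: le_trans (ler_wpM2l N0 sle) _.
rewrite mulrCA -expr2 [2 * _]mulrC -mulrA.
by apply: ler_wpM2l; [exact: sqrtr_ge0|exact: b1].
Qed.
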